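(* Let $\Phi$ be an asymptotically free finite set of pairwise similar local restriction functions and let $\Phi'$ be a finite set of local restriction functions similar to those in $\Phi$. Then the constants $r$, $B$ and $C$ (defined below) are the same for $\mathcal C_\Phi$ and for $\mathcal C_{\Phi'}$.
   Context: A composition is a finite sequence $\mathbf c=c_1\cdots c_k$ of positive integers; ${\rm len}(\mathbf c)=k$, $\Sigma(\mathbf c)=\sum_i c_i$, and $\mathbf c$ is a composition of $n$ if $\Sigma(\mathbf c)=n$. A subcomposition is a nonempty block of consecutive parts; juxtaposition denotes concatenation. For $m,p\in\mathbb N$, a local restriction function of type $(m,p)$ is $\phi:\{0,\dots,m-1\}\times\mathbb N_0^{p+1}\to\{0,1\}$ with $\phi(i;0,\dots,0)=1$ for all $i$. $\mathcal C_\phi$ is the set of compositions $\mathbf c$ with $\phi(i\bmod m;c_i,c_{i-1},\dots,c_{i-p})=1$ for all $i\in\mathbb Z$, where $c_j:=0$ if $j<1$ or $j>{\rm len}(\mathbf c)$; $\mathcal C_\Phi=\bigcup_{\phi\in\Phi}\mathcal C_\phi$. A subcomposition $\mathbf s$ is recurrent at $j$ modulo $m$ in $\mathcal C_\phi$ if for every $k$ and every $\mathbf a\mathbf x\mathbf z\in\mathcal C_\phi$ with ${\rm len}(\mathbf a),{\rm len}(\mathbf z)\ge p$ there is $\mathbf a\mathbf y\mathbf z\in\mathcal C_\phi$ containing at least $k$ copies of $\mathbf s$ starting at positions $\equiv j$ mod $m$; recurrent = recurrent at some $j$. $\phi$ is recurrent if every subcomposition $c_i\cdots c_j$ of every $\mathbf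 c\in\mathcal C_\phi$ with $i>p$, $j+p\le{\rm len}(\mathbf c)$ is recurrent. Recurrent $\phi,\phi'$ of the same type $(m,p)$ are similar if there is $k$ with: $\mathbf s$ recurrent at $j$ mod $m$ in $\mathcal C_\phi$ iff recurrent at $j+k$ mod $m$ in $\mathcal C_{\phi'}$. $\phi$ is asymptotically free if it is recurrent and (a) whenever $\mathbf r(x)=r_1\cdots r_p\,x\,r_{p+2}\cdots r_{2p+1}$ is recurrent at $j$ mod $m$ for infinitely many $x$, there is $M$ such that whenever $\mathbf r(x)$ occurs at a position $\equiv j$ mod $m$ in a composition of $\mathcal C_\phi$, $x$ may be replaced by any $x'\ge M$ staying in $\mathcal C_\phi$; (b) at least one such $j,r_i$ exist. A finite set $\Phi$ of pairwise similar local restriction functions is asymptotically free if some member is. For such a class, $r$ is the radius of convergence of $\sum_n N(n)x^n$, $N(n)$ the number of compositions of $n$ in the class (known: $N(n)\sim Ar^{-n}$, $A>0$, $0<r<1$). For a uniformly random composition of $n$ in the class let $X_0(n)$ be the number of parts and $X_k(n)$ the number of parts equal to $k$; the limits $u_k=\lim_n\mathsf E(X_k(n))/\mathsf E(X_0(n))$ exist and $u_k\sim Br^k$ ($k\to\infty$) for a constant $B>0$; $C:=B\lim_{n\to\infty}\mathsf E(X_0(n))/n$. *)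

(* Defs.v *)
(* Combinatorics: MathComp and its classical sets; limits and power series over
   the real numbers of Stdlib: Coquelicot. *)
From mathcomp Require Import all_boot ssralg ssrnum ssrint intdiv.
From mathcomp Require Import finmap boolp classical_sets cardinality.

Set Implicit Arguments.
Unset Strict Implicit.
Unset Printing Implicit Defensive.

Local Open Scope nat_scope.
Local Open Scope classical_set_scope.

(* Local restriction functions of type (m, p). *)
Record lrf (m p : nat) := Lrf {
  lrf_fun :> 'I_m -> p.+1.-tuple nat -> bool;
  lrf_zero : forall i : 'I_m, lrf_fun i [tuple of nseq p.+1 0]
}.

(* [part c i] is c_i, with parts numbered from 1 and c_i = 0 out of range
   ([nth] returns 0 beyond the last part). *)
Definition part (c : seq nat) (i : int) : nat :=
  if i is Posz j.+1 then nth 0 c j else 0.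

(* The window (c_i, c_(i-1), ..., c_(i-p)). *)
Definition window (p : nat) (c : seq nat) (i : int) : p.+1.-tuple nat :=
  [tuple part c (i - (l : nat)%:Z)%R | l < p.+1].

(* A composition is a possibly empty sequence of positive integers. *)
Definition composition (c : seq nat) : bool := all (fun x => 0 < x) c.

Definition comp_class m p (phi : lrf m p) : set (seq nat) :=
  [set c | composition c /\
    forall (i : int) (h : 'I_m), (i %% m)%Z = h ->
      phi h (window p c i)].

Definition union_class m p (Phi : set (lrf m p)) : set (seq nat) :=
  \bigcup_(phi in Phi) comp_class phi.

(* Number of (possibly overlapping) copies of s in c whose starting position
   is congruent to j modulo m. *)
Definition copies (m j : nat) (s c : seq nat) : nat :=
  count (fun l => prefix s (drop l c) && (l.+1 == j %[mod m])) (iota 0 (size c)).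

(* [s] has to be a subcomposition of some member of the class; this keeps the
   universally quantified condition from holding vacuously when the class has
   no composition with at least 2p parts. *)
Definition recurrent_at m p (phi : lrf m p) (j : nat) (s : seq nat) : Prop :=
  [/\ s != [::],
      exists2 c, comp_class phi c & infix s c
    & forall (k : nat) (a x z : seq nat),
        comp_class phi (a ++ x ++ z) -> p <= size a -> p <= size z ->
        exists2 y, comp_class phi (a ++ y ++ z)
                 & k <= copies m j s (a ++ y ++ z)].

Definition recurrent m p (phi : lrf m p) : Prop :=
  forall a s z : seq nat, comp_class phi (a ++ s ++ z) -> s != [::] ->
    p <= size a -> p <= size z -> exists j, recurrent_at phi j s.

Definition similar m p (phi phi' : lrf m p) : Prop :=
  [/\ recurrent phi, recurrent phi'
    & exists k : nat, forall (j : nat) (s : seq nat),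
        recurrent_at phi j s <-> recurrent_at phi' (j + k) s].

(* r(x) = r_1 ... r_p x r_(p+2) ... r_(2p+1) is recurrent at j modulo m for
   infinitely many x. *)
Definition inf_recurrent m p (phi : lrf m p) (j : nat) (l r : p.-tuple nat) :=
  infinite_set [set x | recurrent_at phi j (l ++ x :: r)].

Definition asymptotically_free m p (phi : lrf m p) : Prop :=
  [/\ recurrent phi,
      forall (j : nat) (l r : p.-tuple nat), inf_recurrent phi j l r ->
        exists M : nat, forall (x : nat) (a z : seq nat),
          comp_class phi (a ++ (l ++ x :: r) ++ z) ->
          (size a).+1 = j %[mod m] ->
          forall x' : nat, M <= x' ->
            comp_class phi (a ++ (l ++ x' :: r) ++ z)
    & exists (j : nat) (l r : p.-tuple nat), inf_recurrent phi j l r].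

Definition asymptotically_free_set m p (Phi : set (lrf m p)) : Prop :=
  [/\ finite_set Phi,
      forall phi phi', Phi phi -> Phi phi' -> similar phi phi'
    & exists2 phi, Phi phi & asymptotically_free phi].

(* Required only here, as this rebinds the scope delimiter %R. *)
From Stdlib Require Import Reals.
From Coquelicot Require Import Coquelicot.

Local Open Scope nat_scope.

Section Counting.
Variables (m p : nat) (Phi : set (lrf m p)).

Definition class_of_sum (n : nat) : set (seq nat) :=
  union_class Phi `&` [set c | sumn c = n].

(* [fset_set], used below, is only meaningful on finite sets. *)
Lemma finite_class_of_sum n : finite_set (class_of_sum n).
Proof.
apply: (@sub_finite_set _ _
  ((fun t : n.-bseq 'I_n.+1 => map (@nat_of_ord n.+1) t) @` setT)).
  move=> c [[phi _ [cpos _]] /= cn].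
  have szn : size c <= n.
    rewrite -cn; elim: c cpos {cn} => //= x c IHc /andP[x0 /IHc].
    by rewrite -add1n; apply: leq_add.
  have len x : x \in c -> x <= n.
    rewrite -cn; elim: c {cpos cn szn} => //= y c IHc; rewrite inE.
    by case/orP => [/eqP->|/IHc h]; [exact: leq_addr | apply: leq_trans h (leq_addl _ _)].
  have szm : size [seq inord x : 'I_n.+1 | x <- c] <= n by rewrite size_map.
  exists (Bseq szm) => //=; rewrite -map_comp -[RHS]map_id.
  by apply/eq_in_map => x /len xn /=; rewrite inordK.
by apply: finite_image; exact: finite_finset.
Qed.

Definition fclass (n : nat) : {fset seq nat} := fset_set (class_of_sum n).

Definition num (n : nat) : R := INR #|` fclass n |.

(* Expectation of X for the uniform distribution on the compositions of n in
   the class. *)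
Definition expect (n : nat) (X : seq nat -> nat) : R :=
  (INR (\sum_(c <- fclass n) X c) / num n)%R.

(* r, B and C are the constants attached to the class: X_0 is [size], X_k is
   [count_mem k] for k >= 1, and u_k ~ B r^k. *)
Definition has_constants (r B C : R) : Prop :=
  CV_radius num = Finite r /\
  (0 < B)%R /\
  exists (u : nat -> R) (ell : R),
    (forall k : nat, 0 < k ->
       is_lim_seq (fun n => (expect n (count_mem k) / expect n size)%R)
                  (Finite (u k))) /\
    is_lim_seq (fun k => (u k / (B * r ^ k))%R) (Finite 1) /\
    is_lim_seq (fun n => (expect n size / INR n)%R) (Finite ell) /\
    C = (B * ell)%R.

End Counting.

(* Main.v *)
(* Interior words of a class depend only on gluing along blocks of p parts, and
   recurrence makes the resulting graph of states (residue, block) strongly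
   connected; similarity only shifts residues. Fix a state s next to a part that
   can be changed freely. A long composition is a short beginning, a sequence of
   prime loops at s, and a short end, so everything is governed by the series
   f(x) = sum of x^|w| over the prime loops w, which is the same for all the
   similar classes, and r is the point where f reaches 1.

   Words avoiding s have a generating function converging beyond r: words without
   p consecutive small parts have small weight, and the finitely many remaining
   states are dealt with one at a time. Hence f converges beyond r and, tilting
   the weights by exp(t Y), compositions of n in which a letter count X is not
   within e n of v n, where v is the mean of X per unit of sum under the weights
   r^|w|, are exponentially rare. Since the rare sets only need upper bounds, this
   passes to finite unions without inclusion-exclusion, and it gives the limits of
   E(X)/n with values that depend on the prime loops only. Finally, dominated
   convergence over prime loops with a marked hole yields u_k / r^k -> B > 0. *)
From mathcomp Require Import all_boot all_order all_algebra finmap.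
From mathcomp Require Import boolp classical_sets cardinality reals normedtype.
From mathcomp Require Import sequences exp.
From mathcomp Require Import zify ring lra.
Require Import Defs.

Set Implicit Arguments.
Unset Strict Implicit.
Unset Printing Implicit Defensive.
Import Order.TTheory GRing.Theory Num.Theory numFieldNormedType.Exports.
Local Open Scope nat_scope.
Local Open Scope ring_scope.

(** Each class is squeezed between two families built from one fixed interior language: from below
    the loops at the state placed between one fixed pair of ends, from above the [hull], where up to
    [p] parts at either end are arbitrary. Lower bounds x^n N(n) >= c, valid for every x > r, are
    played against upper bounds at a rate b > r for the rare sets; choosing x between r and b
    absorbs ends and unions alike.

    The state follows a freely changeable part for three reasons: this gives prime loops of every
    large sum, it gives two different prime loops, whence r < 1, and it makes the limit of the holes
    positive.

    The constants come out explicitly. Let mu be the sum of r^|w| |w| over the prime loops, and H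
    the total weight of the prime loops with a hole that every large part can fill. The frequency of
    the part k per unit of sum is asymptotic to (H / mu) r^k. Hence C = H / mu, and B = C / v0 with
    v0 the number of parts per unit of sum. *)

Section BoundedSums.
Variable R : realType.

(* For [g >= 0] on [A]: the possibly infinite sum of [g] over [A] is at most [M]. *)
Definition bsum (T : eqType) (A : T -> Prop) (g : T -> R) (M : R) : Prop :=
  forall l, uniq l -> (forall t, t \in l -> A t) -> \sum_(t <- l) g t <= M.

Lemma bsum_ge0 (T : eqType) (A : T -> Prop) g M : bsum A g M -> 0 <= M.
Proof. by move=> /(_ [::] isT); rewrite big_nil; apply. Qed.

Lemma bsum_le (T : eqType) (A B : T -> Prop) g h M N :
  (forall t, A t -> B t) -> (forall t, A t -> g t <= h t) -> M <= N ->
  bsum B h M -> bsum A g N.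
Proof.
move=> AB gh MN bB l ul lA; apply: le_trans MN.
apply: le_trans (bB l ul _); last by move=> t /lA /AB.
by rewrite big_seq [leRHS]big_seq; apply: ler_sum => t /lA /gh.
Qed.

Lemma bsum_sub (T : eqType) (A B : T -> Prop) g M :
  (forall t, A t -> B t) -> bsum B g M -> bsum A g M.
Proof. by move=> AB; apply: bsum_le. Qed.

Lemma bsum0 (T : eqType) (A : T -> Prop) g : (forall t, ~ A t) -> bsum A g 0.
Proof.
move=> nA [|t l] _ lA; first by rewrite big_nil.
by case: (nA t); apply: lA; rewrite inE eqxx.
Qed.

Lemma bsum1 (T : eqType) (t : T) g : 0 <= g t -> bsum (fun u => u = t) g (g t).
Proof.
move=> g0 [|u l] ul lt; first by rewrite big_nil.
have uE : u = t by apply: lt; rewrite mem_head.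
case: l ul lt => [|v l] ul lt; first by rewrite big_seq1 uE.
have vE : v = t by apply: lt; rewrite !inE eqxx orbT.
have : uniq [:: u, v & l] by [].
by rewrite uE vE /= inE eqxx.
Qed.

Lemma bsumU (T : eqType) (A B C : T -> Prop) g M N :
  (forall t, C t -> A t \/ B t) -> bsum A g M -> bsum B g N -> bsum C g (M + N).
Proof.
move=> CAB bA bB l ul lC; rewrite (bigID (fun t => `[< A t >])) /=.
rewrite -!(big_filter l); apply: lerD.
  by apply: bA; [exact: filter_uniq | move=> t; rewrite mem_filter => /andP[/asboolP]].
apply: bB; first exact: filter_uniq.
by move=> t; rewrite mem_filter => /andP[/asboolPn nA /lC /CAB []].
Qed.

Lemma bsum_inj (S T : eqType) (f : S -> T) (A : S -> Prop) (B : T -> Prop) g h M :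
  injective f -> (forall s, A s -> B (f s)) -> (forall s, A s -> h s <= g (f s)) ->
  bsum B g M -> bsum A h M.
Proof.
move=> finj AB hg bB l ul lA; apply: (@le_trans _ _ (\sum_(t <- map f l) g t)).
  by rewrite big_map [leLHS]big_seq [leRHS]big_seq; apply: ler_sum => t /lA /hg.
by apply: bB; [rewrite map_inj_uniq | move=> _ /mapP[t /lA /AB ? ->]].
Qed.

Lemma bsumZ (T : eqType) (A : T -> Prop) (c : R) g M :
  0 <= c -> bsum A g M -> bsum A (fun t => c * g t) (c * M).
Proof. by move=> c0 bA l ul lA; rewrite -big_distrr ler_wpM2l // bA. Qed.

Lemma bsum_finite (T : eqType) (l : seq T) g :
  (forall t, t \in l -> 0 <= g t) -> bsum (fun t => t \in l) g (\sum_(t <- l) g t).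
Proof.
move=> + l'; elim: l' l => [|t l' IHl] l g0 /=.
  by rewrite big_nil big_seq sumr_ge0.
move=> /andP[tl' ul'] ll'; have tl: t \in l by apply: ll'; rewrite inE eqxx.
have lE := perm_mem (perm_to_rem tl).
rewrite big_cons (perm_big _ (perm_to_rem tl)) big_cons lerD2l.
apply: IHl => // [u ul|u ul]; first by apply: g0; rewrite lE inE ul orbT.
have /ll' : u \in t :: l' by rewrite inE ul orbT.
rewrite lE inE => /orP[/eqP ut|//].
by move: tl'; rewrite -ut ul.
Qed.

Lemma sum_sub_le (T : eqType) (l l' : seq T) (g : T -> R) :
  (forall t, t \in l' -> 0 <= g t) -> uniq l -> {subset l <= l'} ->
  \sum_(t <- l) g t <= \sum_(t <- l') g t.
Proof. by move=> g0 ul ll'; apply: (@bsum_finite _ l' g g0). Qed.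

(** Terms being nonnegative, adjoining [l0] to a list only raises its sum. This serves bounds that
    rest on a signed sum whose sign is settled only once the list contains enough of [A]. *)
Lemma bsum_ext (T : eqType) (A : T -> Prop) g M (l0 : seq T) :
  (forall t, A t -> 0 <= g t) -> uniq l0 -> (forall t, t \in l0 -> A t) ->
  (forall l, uniq l -> (forall t, t \in l -> A t) -> {subset l0 <= l} ->
     \sum_(t <- l) g t <= M) ->
  bsum A g M.
Proof.
move=> g0 ul0 l0A bA l ul lA.
have h t : t \in undup (l0 ++ l) = (t \in l0) || (t \in l).
  by rewrite mem_undup mem_cat.
apply: le_trans (bA (undup (l0 ++ l)) (undup_uniq _) _ _).
- apply: sum_sub_le => // t; rewrite h; last by move=> ->; rewrite orbT.
  by move=> /orP[/l0A|/lA] /g0.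
- by move=> t; rewrite h => /orP[/l0A|/lA].
- by move=> t; rewrite h => ->.
Qed.

Lemma bsum_pair (S T : eqType) (A : S -> Prop) (B : T -> Prop) g h M N :
  (forall u, 0 <= g u) -> (forall v, 0 <= h v) -> bsum A g M -> bsum B h N ->
  bsum (fun t : S * T => A t.1 /\ B t.2) (fun t => g t.1 * h t.2) (M * N).
Proof.
move=> g0 h0 bA bB l ul lAB.
set s1 := undup (map fst l); set s2 := undup (map snd l).
apply: (@le_trans _ _ (\sum_(u <- s1) \sum_(v <- s2) g u * h v)).
  rewrite -(big_allpairs_dep (h := fun (u : S) (v : T) => (u, v)) (r2 := fun=> s2)
    (F := fun t => g t.1 * h t.2)).
  apply: sum_sub_le => // [t _|[u v] tl]; first by rewrite mulr_ge0.
  by apply: (allpairs_f pair); rewrite mem_undup; apply/mapP; exists (u, v).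
under eq_bigr do rewrite -big_distrr /=.
rewrite -big_distrl /=; apply: ler_pM; rewrite ?sumr_ge0 //.
  by apply: bA; rewrite ?undup_uniq // => u; rewrite mem_undup => /mapP[t /lAB[At _] ->].
by apply: bB; rewrite ?undup_uniq // => u; rewrite mem_undup => /mapP[t /lAB[_ Bt] ->].
Qed.

(** [sup] is meaningful only on bounded sets, so facts about [ssum] are drawn from some bound
    [bsum A g M]. *)
Definition ssum (T : eqType) (A : T -> Prop) (g : T -> R) : R :=
  sup [set x | exists l, [/\ uniq l, forall t, t \in l -> A t & x = \sum_(t <- l) g t]].

Section Ssum.
Variables (T : eqType) (A : T -> Prop) (g : T -> R) (M : R).
Hypothesis bA : bsum A g M.

Let S : set R :=
  [set x | exists l, [/\ uniq l, forall t, t \in l -> A t & x = \sum_(t <- l) g t]].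

Let supS : has_sup S.
Proof.
split; first by exists 0, [::]; rewrite big_nil.
by exists M => _ [l [ul lA ->]]; exact: bA.
Qed.

Lemma bsum_ssum : bsum A g (ssum A g).
Proof. by move=> l ul lA; apply: sup_upper_bound supS _ _; exists l. Qed.

Lemma ssum_le : ssum A g <= M.
Proof.
by apply: ge_sup; [case: supS | move=> _ [l [ul lA ->]]; exact: bA].
Qed.

Lemma ssum_adherent e : 0 < e ->
  exists l, [/\ uniq l, forall t, t \in l -> A t & ssum A g - e < \sum_(t <- l) g t].
Proof.
by move=> e0; have [_ [l [ul lA ->]] h] := sup_adherent e0 supS; exists l.
Qed.

End Ssum.

(** Dominated convergence in finite form: [L] carries all but [e] of the dominating family [D], so
    what [A] has outside [L] costs at most [e], and what it has inside [L] lies in [B]. *)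
Lemma ssum_perturb (T : eqType) (A B D : T -> Prop) g M e (L : seq T) :
  (forall t, 0 <= g t) -> bsum D g M -> uniq L -> (forall t, t \in L -> D t) ->
  ssum D g - e <= \sum_(t <- L) g t ->
  (forall t, A t -> D t) -> (forall t, B t -> D t) ->
  (forall t, t \in L -> A t -> B t) -> ssum A g <= ssum B g + e.
Proof.
move=> g0 bD uL LD De AD BD LAB; apply: ssum_le => l ul lA.
rewrite (bigID (mem L)) /= -!(big_filter l); apply: lerD.
  apply: (bsum_ssum (bsum_sub BD bD)); first exact: filter_uniq.
  by move=> t; rewrite mem_filter => /andP[tL /lA]; exact: LAB.
set l' := [seq t <- l | t \notin L].
suff : \sum_(t <- l' ++ L) g t <= ssum D g by rewrite big_cat /=; lra.
apply: (bsum_ssum bD) => [|t]; last first.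
  by rewrite mem_cat mem_filter => /orP[/andP[_ /lA /AD]|/LD].
rewrite cat_uniq uL filter_uniq // andbT; apply/hasPn => t tL.
by rewrite mem_filter /= tL.
Qed.

End BoundedSums.

(** * Multiplicative weights on words *)

Section WordSums.
Variable R : realType.
Implicit Types (A B : seq nat -> Prop) (g : seq nat -> R).

Definition word_weight g : Prop :=
  [/\ g [::] = 1, forall u v, g (u ++ v) = g u * g v & forall u, 0 < g u].

(** A word may factor in several ways: one factorization is chosen for each word, and distinct words
    give distinct pairs. *)
Lemma bsum_cat A B g M N : word_weight g -> bsum A g M -> bsum B g N ->
  bsum (fun w => exists u v, [/\ w = u ++ v, A u & B v]) g (M * N).
Proof.
move=> [g1 gM gp] bA bB l ul lAB; have g0 u : 0 <= g u by exact: ltW.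
have {lAB} [s [lE sA sB]] : exists s : seq (seq nat * seq nat),
    [/\ l = [seq x.1 ++ x.2 | x <- s],
        forall x, x \in s -> A x.1 & forall x, x \in s -> B x.2].
  elim: l {ul} lAB => [|w l IHl] lAB; first by exists [::].
  have [|s [-> sA sB]] := IHl; first by move=> t tl; apply: lAB; rewrite inE tl orbT.
  have [|u [v [-> Au Bv]]] := lAB w; first by rewrite inE eqxx.
  by exists ((u, v) :: s); split=> // x; rewrite inE => /orP[/eqP->//|]; auto.
have /= := @bsum_pair _ _ _ _ _ _ _ _ _ g0 g0 bA bB s _ (fun x xs => conj (sA x xs) (sB x xs)).
move=> h; rewrite lE in ul *; rewrite big_map (eq_bigr _ (fun x _ => gM x.1 x.2)).
by apply: h; exact: map_uniq ul.
Qed.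

(** M / (1 - q) is the fixed point of S = M + q S. As [u] is nonempty, induction on the length of
    the words gives the bound before any convergence is known. *)
Lemma bsum_star A B (E : seq nat -> Prop) g M q : word_weight g -> q < 1 ->
  (forall w, E w -> A w \/ exists u v, [/\ w = u ++ v, u != [::], B u & E v]) ->
  bsum A g M -> bsum B g q -> bsum E g (M / (1 - q)).
Proof.
move=> gm q1 EAB bA bB l ul lE; have q0 : 0 < 1 - q by lra.
have M0 := bsum_ge0 bA; have qge0 := bsum_ge0 bB.
have h n : bsum (fun w => E w /\ (size w <= n)%N) g (M / (1 - q)).
  have eqM : M / (1 - q) = M + q * (M / (1 - q)) by field; lra.
  elim: n => [|n IHn].
    apply: bsum_le bA; rewrite ?ler_pdivlMr //; last by nra.
    move=> w [/EAB[//|[u [v [-> u0 _ _]]]]]; rewrite size_cat.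
    by case: (u) u0.
  rewrite eqM; apply: bsumU bA (bsum_cat gm bB IHn) => w [/EAB[|[u [v [-> u0 Bu Ev]]]] sw].
    by left.
  right; exists u, v; split=> //; split=> //.
  by move: sw u0; rewrite size_cat -size_eq0; lia.
apply: (h (\max_(w <- l) size w)) => // w wl; split; first exact: lE.
exact: leq_bigmax_seq.
Qed.

Definition pw (x : R) (w : seq nat) : R := x ^+ sumn w.

Lemma pw_mult x : 0 < x -> word_weight (pw x).
Proof.
move=> x0; split=> [|u v|u]; first by rewrite /pw expr0.
  by rewrite /pw sumn_cat exprD.
exact: exprn_gt0.
Qed.

Lemma pw_le x y w : 0 <= x -> x <= y -> pw x w <= pw y w.
Proof. by move=> x0 xy; rewrite /pw lerXn2r // nnegrE (le_trans x0). Qed.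

Lemma pw_gt0 x w : 0 < x -> 0 < pw x w.
Proof. exact: exprn_gt0. Qed.

Lemma bsum_letter (x : R) (K : nat) : 0 <= x < 1 ->
  bsum (fun w => exists2 k, (K <= k)%N & w = [:: k]) (pw x) (x ^+ K / (1 - x)).
Proof.
move=> /andP[x0 x1] l ul lK.
pose n := (\max_(w <- l) sumn w).+1.
apply: (@le_trans _ _ (\sum_(w <- [seq [:: k] | k <- index_iota K (K + n)]) pw x w)).
  apply: sum_sub_le => // [w _|w wl]; first exact: exprn_ge0.
  have [k Kk wE] := lK w wl; rewrite wE; apply: map_f; rewrite mem_index_iota Kk /=.
  have: (sumn w < n)%N by rewrite ltnS; exact: leq_bigmax_seq.
  by rewrite wE /= addn0 => kn; rewrite (leq_trans kn) ?leq_addl.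
rewrite big_map -{1}[K]add0n big_addn addKn.
under eq_bigr do rewrite /pw /= addn0 addnC exprD.
rewrite -big_distrr /= ler_wpM2l ?exprn_ge0 // big_mkord.
rewrite -[leRHS]mul1r ler_pdivlMr ?subr_gt0 // mulrC.
have := subrX1 x n; rewrite -opprB -[x - 1]opprB mulNr => /oppr_inj <-.
by rewrite gerBl exprn_ge0.
Qed.

End WordSums.

(** * Local families of words *)

Section LocalLanguages.
Local Open Scope nat_scope.
Variables m p : nat.
Hypothesis p0 : 0 < p.
Implicit Types (J : nat -> seq nat -> Prop) (s u v w b : seq nat) (t : nat * seq nat).

(* [J i s] reads: the word [s] may occur in the interior of a composition with its
   first part at position [i] modulo [m]. The third clause says that such words
   are glued along blocks of [p] parts. *)
Definition local_family J : Prop :=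
  [/\ forall i j s, i = j %[mod m] -> J i s -> J j s,
      forall i u s v, J i (u ++ s ++ v) -> J (i + size u) s,
      forall i u b v, p <= size b ->
        J i (u ++ b) -> J (i + size u) (b ++ v) -> J i (u ++ b ++ v)
    & forall i s, J i s -> all (leq 1) s].

(* A state [t] is a residue modulo [m] together with a block of [p] parts; it occurs
   at offset [l] in the word [s] whose first part is at position [i]. *)
Definition occ t i s l : bool := prefix t.2 (drop l s) && (i + l == t.1 %[mod m]).

Definition avoiding J t i s : Prop := J i s /\ forall l, ~~ occ t i s l.

(** [w] lists only the parts added after the block of [t], so walks compose by concatenating words.
    When both blocks have [p] parts, the offset [size w] makes the block of [t'] the final one. *)
Definition walk J t t' w : Prop := J t.1 (t.2 ++ w) /\ occ t' t.1 (t.2 ++ w) (size w).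

Definition loop J t := walk J t t.

Definition prime_loop J t w : Prop :=
  [/\ loop J t w, w != [::]
    & forall l, 0 < l < size w -> ~~ occ t t.1 (t.2 ++ w) l].

Lemma local_sub J i u s v j : local_family J -> J i (u ++ s ++ v) ->
  i + size u = j %[mod m] -> J j s.
Proof. by move=> [Jm Js _ _] /Js Jsv ij; apply: Jm ij _. Qed.

Lemma local_left J i u v : local_family J -> J i (u ++ v) -> J i u.
Proof. by move=> Jl h; apply: (@local_sub J i [::] u v) => //=; rewrite addn0. Qed.

Lemma local_right J i u v j : local_family J -> J i (u ++ v) ->
  i + size u = j %[mod m] -> J j v.
Proof. by move=> Jl h; apply: (@local_sub J i u v [::]) => //=; rewrite cats0. Qed.

Lemma local_splice J i j u b v : local_family J -> p <= size b -> J i (u ++ b) ->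
  i + size u = j %[mod m] -> J j (b ++ v) -> J i (u ++ b ++ v).
Proof. by move=> [Jm _ Jc _] pb ub ij bv; apply: Jc => //; apply: Jm bv. Qed.

Lemma occ_mod t i j s l : i = j %[mod m] -> occ t i s l = occ t j s l.
Proof.
by move=> ij; rewrite /occ; congr (_ && (_ == _)); rewrite -modnDml ij modnDml.
Qed.

Lemma occ_catl t i u s l : occ t i (u ++ s) (size u + l) = occ t (i + size u) s l.
Proof. by rewrite /occ addnA drop_cat ltnNge leq_addr /= addKn. Qed.

Lemma occ_catr t i s v l : l + size t.2 <= size s -> occ t i (s ++ v) l = occ t i s l.
Proof.
clear p p0; move=> ls; rewrite /occ; congr (_ && _).
have ls' : l <= size s by apply: leq_trans ls; exact: leq_addr.
rewrite drop_cat; case: ltnP => // sl.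
  rewrite !prefixE take_cat size_drop; case: ltnP => //.
  move=> h; have -> : size t.2 = size s - l by apply/eqP; rewrite eqn_leq h andbT; lia.
  by rewrite subnn take0 cats0 [in RHS]take_oversize // size_drop.
have -> : l = size s by apply/eqP; rewrite eqn_leq sl ls'.
have /eqP : size t.2 = 0 by lia.
by rewrite size_eq0 => /eqP->; rewrite !prefix0s.
Qed.

Lemma occ_bound t i s l : size t.2 = p -> occ t i s l -> l + p <= size s.
Proof.
move=> tp /andP[/prefixP[v h] _]; have := congr1 size h.
rewrite size_drop size_cat tp; move: (size s) (size v) => a b; lia.
Qed.

Lemma occP t i s l : size t.2 = p -> occ t i s l ->
  s = take l s ++ t.2 ++ drop (l + p) s /\ size (take l s) = l.
Proof.
move=> tp /[dup] /(occ_bound tp) ls /andP[/prefixP[v h] _].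
have sl : size (take l s) = l by rewrite size_takel //; lia.
split=> //; rewrite -{1}(cat_take_drop l s) h; congr (_ ++ (_ ++ _)).
by rewrite addnC -drop_drop h -tp drop_size_cat.
Qed.

Lemma occ_nth t i w k n : size t.2 = p -> occ t i w k -> (k <= n < k + p) ->
  nth 0 w n \in t.2.
Proof.
move=> tp /(occP tp)[E sk] /andP[kn nk]; rewrite E nth_cat sk ltnNge kn /=.
by rewrite nth_cat tp; case: ltnP => [h|]; [rewrite mem_nth // tp | lia].
Qed.

(** An occurrence has [p] parts, so in a word glued along at least [p] parts it lies within one of
    the two glued pieces. Avoidance can therefore be iterated over several states. *)
Lemma avoiding_local J t : local_family J -> size t.2 = p -> local_family (avoiding J t).
Proof.
move=> [Jm Js Jc Jp] tp; split.
- by move=> i j s ij [/(Jm _ _ _ ij) Jjs av]; split=> // l; rewrite -(occ_mod _ _ _ ij).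
- move=> i u s v [/[dup] h /Js Jus av]; split=> // l; apply/negP => ol.
  have ls := occ_bound tp ol.
  by have := av (size u + l); rewrite occ_catl occ_catr ?ol // tp.
- move=> i u b v pb [Ju avu] [Jv avv]; split; first exact: Jc.
  move=> l; have [h|h] := leqP (l + p) (size (u ++ b)).
    by rewrite catA occ_catr ?tp.
  have -> : l = size u + (l - size u) by move: h; rewrite size_cat; lia.
  by rewrite occ_catl.
- by move=> i s [/Jp].
Qed.

Lemma loop_nil J t : size t.2 = p -> J t.1 t.2 -> loop J t [::].
Proof.
by move=> tp Jt; split; rewrite /= cats0 // /occ drop0 prefix_refl addn0 eqxx.
Qed.

Lemma walk_mod J t t' w : walk J t t' w -> t.1 + size w = t'.1 %[mod m].
Proof. by move=> [_ /andP[_ /eqP]]. Qed.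

Lemma walk_suffix J t t' w : size t.2 = p -> size t'.2 = p -> walk J t t' w ->
  exists2 y, t.2 ++ w = y ++ t'.2 & size y = size w.
Proof.
move=> tp tp' [_ /(occP tp')[]]; set y := take _ _ => e sy; exists y => //.
by move: e; rewrite drop_oversize ?cats0 // size_cat tp; lia.
Qed.

Lemma occ_walkl t t' i u v l : size t.2 = p -> size t'.2 = p -> l <= size u ->
  occ t' i (t.2 ++ u ++ v) l = occ t' i (t.2 ++ u) l.
Proof. by move=> tp tp' lu; rewrite catA occ_catr // size_cat tp tp' addnC leq_add2l. Qed.

Lemma occ_walkr J t t' t'' u v l : size t.2 = p -> size t'.2 = p -> walk J t t' u ->
  occ t'' t.1 (t.2 ++ u ++ v) (size u + l) = occ t'' t'.1 (t'.2 ++ v) l.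
Proof.
move=> tp tp' wu; have [y yE sy] := walk_suffix tp tp' wu.
by rewrite catA yE -catA -sy occ_catl sy (occ_mod _ _ _ (walk_mod wu)).
Qed.

Lemma walk_cat J t t' t'' u v : local_family J ->
  size t.2 = p -> size t'.2 = p ->
  walk J t t' u -> walk J t' t'' v -> walk J t t'' (u ++ v).
Proof.
move=> Jl tp tp' /[dup] wu [Ju ou] [Jv ov]; split; last first.
  by rewrite size_cat (occ_walkr _ _ _ tp tp' wu).
have [y yE sy] := walk_suffix tp tp' wu.
rewrite catA yE -catA; apply: (local_splice Jl _ _ _ Jv); rewrite ?tp' -?yE // sy.
exact: walk_mod wu.
Qed.

(** Prime loops form a prefix code: if one were a proper prefix of another, its end would be a
    forbidden early return. *)
Lemma prime_cat_inj J t u v u' v' : size t.2 = p -> prime_loop J t u ->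
  prime_loop J t u' -> u ++ v = u' ++ v' -> u = u'.
Proof.
move=> tp.
wlog le_u : u v u' v' / size u <= size u' => [H|] pu pu' e.
  case/orP: (leq_total (size u) (size u')) => le; first exact: H le pu pu' e.
  by apply/esym; exact: H le pu' pu (esym e).
have uE : take (size u) u' = u by rewrite -(takel_cat v') // -e take_size_cat.
move: le_u; rewrite leq_eqVlt => /orP[/eqP su|lt_u]; first by rewrite -uE su take_size.
have [[_ ou] u0 _] := pu; have [_ _ /(_ (size u))] := pu'.
rewrite lt_u lt0n size_eq0 u0 => /(_ isT) /negP[].
by rewrite -(cat_take_drop (size u) u') uE catA occ_catr // size_cat tp addnC.
Qed.

Lemma prime_of_prefix J t v l : local_family J -> size t.2 = p ->
  J t.1 (t.2 ++ v) -> 0 < l -> occ t t.1 (t.2 ++ v) l ->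
  (forall k, 0 < k < l -> ~~ occ t t.1 (t.2 ++ v) k) ->
  [/\ prime_loop J t (take l v), J t.1 (t.2 ++ drop l v) & take l v != [::]].
Proof.
move=> Jl tp Jv l0 ol lmin.
have lv : l <= size v by have := occ_bound tp ol; rewrite size_cat tp; lia.
have su : size (take l v) = l by rewrite size_takel.
have vE := cat_take_drop l v.
have u0 : take l v != [::] by rewrite -size_eq0 su -lt0n.
have lu : loop J t (take l v).
  split; first by move: Jv; rewrite -{1}vE catA; exact: local_left.
  by move: ol; rewrite -{1}vE catA occ_catr ?su // tp size_cat tp su; lia.
split=> //.
  split=> // k; rewrite su => /andP[k0 kl].
  have := lmin k; rewrite k0 kl -{1}vE catA occ_catr; first exact.
  by rewrite tp size_cat tp su; lia.
have [y yE sy] := walk_suffix tp tp lu; move: Jv; rewrite -{1}vE catA yE -catA => Jv.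
by apply: local_right Jv _; rewrite // sy; exact: walk_mod lu.
Qed.

Variable R : realType.
Local Open Scope ring_scope.

Definition somewhere J s : Prop := exists i, J i s.

(** Deleting the first part of the block destroys the occurrence at offset 0, the only one
    allowed. *)
Lemma avoiding_tail J t v : local_family J -> size t.2 = p ->
  J t.1 (t.2 ++ v) -> (forall l, (0 < l)%N -> ~~ occ t t.1 (t.2 ++ v) l) ->
  somewhere (avoiding J t) (behead t.2 ++ v).
Proof.
move=> Jl tp Jv av; exists (t.1 + 1)%N; case: t tp Jv av => r [|b bs] /= tp Jv av.
  by move: p0; rewrite -tp.
split; first by apply: (@local_right J r [:: b] (bs ++ v)).
move=> l; have := @occ_catl (r, b :: bs) r [:: b] (bs ++ v) l.
by rewrite /= => <-; apply: av.
Qed.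

Lemma bsum_avoiding_tail J t (g : seq nat -> R) M : word_weight g ->
  local_family J -> size t.2 = p -> bsum (somewhere (avoiding J t)) g M ->
  bsum (fun v => J t.1 (t.2 ++ v) /\
                 forall l, (0 < l)%N -> ~~ occ t t.1 (t.2 ++ v) l)
       g (M / g (behead t.2)).
Proof.
move=> [g1 gM gp] Jl tp bM; rewrite mulrC.
have b0 := gp (behead t.2).
apply: (@bsum_inj _ _ _ (fun v => behead t.2 ++ v) _ (somewhere (avoiding J t))
  (fun w => (g (behead t.2))^-1 * g w)).
- by move=> u v /eqP; rewrite eqseq_cat // eqxx => /eqP.
- by move=> v [Jv av]; exact: avoiding_tail.
- by move=> v _; rewrite gM mulKf // gt_eqF.
by apply: bsumZ; rewrite // invr_ge0 ltW.
Qed.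

(* A word visiting [t] is its part up to the first visit, followed by prime loops at
   [t] and by a last stretch that does not come back to [t]. *)
Lemma bsum_eliminate J t (g : seq nat -> R) M q : word_weight g ->
  local_family J -> size t.2 = p ->
  bsum (somewhere (avoiding J t)) g M -> bsum (prime_loop J t) g q -> q < 1 ->
  exists M', bsum (somewhere J) g M'.
Proof.
move=> gm Jl tp bM bq q1; have [g1 gM gp] := gm.
case/lastP tE : t.2 tp => [|bs b] tp; first by move: p0; rewrite -tp.
rewrite -tE in tp.
(* [bs] is the block short of its last part: the part of the word before the first visit, followed
   by [bs], still avoids [t]. *)
pose U u := somewhere (avoiding J t) (u ++ bs).
have bU : bsum U g ((g bs)^-1 * M).
  apply: (@bsum_inj _ _ _ (cat^~ bs) _ (somewhere (avoiding J t))
    (fun w => (g bs)^-1 * g w)) => //.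
  - apply: (can_inj (g := fun w => take (size w - size bs) w)) => u.
    by rewrite size_cat addnK take_size_cat.
  - by move=> v _; rewrite gM mulrCA mulVf ?mulr1 // gt_eqF.
  by apply: bsumZ; rewrite // invr_ge0 ltW.
pose V v := J t.1 (t.2 ++ v).
have bV : bsum V g (M / g (behead t.2) / (1 - q)).
  apply: bsum_star gm q1 _ (bsum_avoiding_tail gm Jl tp bM) bq => v Vv.
  have [/asboolP av|/asboolPn] :=
    boolP `[< forall l, (0 < l)%N -> ~~ occ t t.1 (t.2 ++ v) l >]; first by left.
  move=> /existsNP[l0 /not_implyP[l0p /negP/negPn ol0]]; right.
  have ex : exists l, (0 < l)%N && occ t t.1 (t.2 ++ v) l by exists l0; rewrite l0p.
  case: (ex_minnP ex) => l /andP[l1 ol] lmin.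
  have [] := prime_of_prefix Jl tp Vv l1 ol.
    by move=> k /andP[k0 kl]; apply/negP => ok; have := lmin k; rewrite k0 ok; lia.
  by exists (take l v), (drop l v); rewrite cat_take_drop.
exists (M + (g bs)^-1 * M * (g t.2 * (M / g (behead t.2) / (1 - q)))).
apply: bsumU bM (bsum_cat gm bU (bsum_cat gm (bsum1 (t := t.2) (ltW (gp _))) bV)).
move=> s [i Js].
have [/asboolP av|/asboolPn] := boolP `[< forall l, ~~ occ t i s l >].
  by left; exists i.
move=> /existsNP[l0 /negP/negPn ol0]; right.
case: (ex_minnP (ex_intro _ l0 ol0)) => l ol lmin.
have [sE sl] := occP tp ol; move: sE sl; set u := take _ _; set v := drop _ _ => sE sl.
exists u, (t.2 ++ v); split=> //; last first.
  exists t.2, v; split=> //; rewrite sE in Js.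
  by apply: (local_right Jl Js); rewrite sl; case/andP: ol => _ /eqP.
exists i; rewrite tE cat_rcons catA in sE; split.
  by move: Js; rewrite sE; exact: local_left.
move=> k; apply/negP => ok; have kb := occ_bound tp ok.
have : occ t i s k by rewrite sE occ_catr // tp.
move/lmin; move: kb; rewrite size_cat sl -tp tE size_rcons; lia.
Qed.

(* A loop is empty or a prime loop followed by a loop: if [S] is the sum over loops
   and [Q] the sum over prime loops, then [1 + Q * S <= S]. *)
Lemma bsum_prime_lt1 J t (g : seq nat -> R) M : word_weight g ->
  local_family J -> size t.2 = p -> bsum (loop J t) g M ->
  exists2 q, q < 1 & bsum (prime_loop J t) g q.
Proof.
move=> gm Jl tp bM; have [g1 gM gp] := gm.
have [/asboolP Jt|/asboolPn Jt] := boolP `[< J t.1 t.2 >]; last first.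
  by exists 0; rewrite ?ltr01 //; apply: bsum0 => w [[/(local_left Jl)]].
set S := ssum (loop J t) g; have bS : bsum (loop J t) g S := bsum_ssum bM.
have S1 : 1 <= S.
  have := bS [:: [::]]; rewrite big_seq1 g1; apply=> // w.
  by rewrite inE => /eqP->; exact: loop_nil.
exists (1 - S^-1); first by rewrite ltrBlDr ltrDl invr_gt0; lra.
move=> P uP PP; set q := \sum_(w <- P) g w.
have q0 : 0 <= q by apply: sumr_ge0 => w _; exact: ltW.
suff : 1 + q * S <= S.
  have S0 : 0 < S by lra.
  move=> h; suff : q <= (S - 1) / S by rewrite mulrBl divff ?gt_eqF // mul1r.
  by rewrite ler_pdivlMr //; lra.
move: q0; rewrite le_eqVlt => /orP[/eqP<-|q0]; first by lra.
suff : S <= (S - 1) / q by rewrite ler_pdivlMr //; lra.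
apply: ssum_le => L uL LL; rewrite ler_pdivlMr // mulrC.
suff : 1 + q * \sum_(w <- L) g w <= S by lra.
pose F := [::] :: [seq u ++ v | u <- P, v <- L].
have <- : \sum_(w <- F) g w = 1 + q * \sum_(w <- L) g w.
  rewrite big_cons g1 big_allpairs_dep /q big_distrl; congr (_ + _).
  by apply: eq_bigr => u _; rewrite big_distrr; apply: eq_bigr => v _; rewrite gM.
apply: bS.
  rewrite /= allpairs_uniq_dep // ?andbT; last first.
    move=> _ _ /allpairsPdep[u [v [uP' vL ->]]] /allpairsPdep[u' [v' [uP'' vL' ->]]] /= e.
    have uu := prime_cat_inj tp (PP _ uP') (PP _ uP'') e; move: e; rewrite uu => /eqP.
    by rewrite eqseq_cat // eqxx => /eqP->.
  apply/negP => /allpairsPdep[u [v [/PP[_ u0 _] _]]] /esym/eqP.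
  by move: u0; rewrite -!size_eq0 size_cat; lia.
move=> w; rewrite inE => /orP[/eqP->|]; first exact: loop_nil.
move=> /allpairsPdep[u [v [/PP[lu _ _] /LL lv ->]]]; exact: (walk_cat Jl tp tp lu lv).
Qed.

(** Convexity of powers by induction on the exponent; the defect at each step is c (1 - c) (x^n -
    y^n) (x - y) >= 0. *)
Lemma pw_convex (x y c : R) w : 0 <= x -> 0 <= y -> 0 <= c <= 1 ->
  pw ((1 - c) * x + c * y) w <= (1 - c) * pw x w + c * pw y w.
Proof.
move=> x0 y0 /andP[c0 c1]; rewrite /pw; elim: (sumn w) => [|n IHn].
  by rewrite !expr0; lra.
rewrite !exprSr; set z := (1 - c) * x + c * y in IHn *.
have z0 : 0 <= z by rewrite /z; nra.
apply: le_trans (ler_wpM2r z0 IHn) _.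
have : 0 <= (x ^+ n - y ^+ n) * (x - y).
  have [xy|/ltW yx] := leP x y.
    by rewrite mulr_le0 // subr_le0 // lerXn2r // nnegrE.
  by rewrite mulr_ge0 // subr_ge0 // lerXn2r // nnegrE.
have : 0 <= c * (1 - c) by nra.
move: (x ^+ n) (y ^+ n) => X Y h1 h2; rewrite /z; have := mulr_ge0 h1 h2; lra.
Qed.

Lemma bsum_interpolate (A : seq nat -> Prop) (x y q M : R) : 0 < x -> x < y -> q < 1 ->
  bsum A (pw x) q -> bsum A (pw y) M ->
  exists z q', [/\ x < z <= y, q' < 1 & bsum A (pw z) q'].
Proof.
move=> x0 xy q1 bq bM; have M0 := bsum_ge0 bM; have q0 := bsum_ge0 bq.
(* With this [c], [c * M] is at most (1 - q) / 2, so the interpolated bound is at most (1 + q) /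
   2. *)
pose c := (1 - q) / (2 * (M + 1)).
have M1 : 0 < 2 * (M + 1) by lra.
have c0 : 0 < c by rewrite divr_gt0 // subr_gt0.
have c1 : c <= 1 by rewrite ler_pdivrMr //; lra.
have cM : c * (2 * (M + 1)) = 1 - q by rewrite /c mulfVK // gt_eqF.
exists ((1 - c) * x + c * y), ((1 - c) * q + c * M); split.
- by apply/andP; split; nra.
- by nra.
move=> l ul lA; apply: (@le_trans _ _ (\sum_(w <- l) ((1 - c) * pw x w + c * pw y w))).
  by apply: ler_sum => w _; apply: pw_convex; lra.
rewrite big_split -!big_distrr /=; apply: lerD; apply: ler_wpM2l; try lra.
  exact: bq.
exact: bM.
Qed.

(** Without its last part a prime loop has not yet returned to [t], and the last part costs a
    geometric series. *)
Lemma bsum_prime_avoiding J t (y M : R) : 0 < y < 1 -> local_family J -> size t.2 = p ->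
  bsum (somewhere (avoiding J t)) (pw y) M ->
  bsum (prime_loop J t) (pw y) (M / pw y (behead t.2) * (y ^+ 0 / (1 - y))).
Proof.
move=> /andP[y0 y1] Jl tp bM.
have yl : 0 <= y < 1 by rewrite ltW.
have ym := pw_mult y0.
have := bsum_cat ym (bsum_avoiding_tail ym Jl tp bM) (bsum_letter (K := 0) yl).
apply: bsum_sub => w [[Jw ow]]; case/lastP: w Jw ow => // w c Jw ow _ av.
exists w, [:: c]; rewrite cats1; split=> //; last by exists c.
have h l : (l <= size w)%N -> occ t t.1 (t.2 ++ rcons w c) l = occ t t.1 (t.2 ++ w) l.
  by move=> lw; rewrite -cats1 catA occ_catr // size_cat addnC leq_add2l.
split; first by move: Jw; rewrite -cats1 catA; exact: local_left.
move=> l l0; apply/negP => /[dup] ol.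
move/(occ_bound tp); rewrite size_cat tp addnC leq_add2l => lw.
have := av l; rewrite l0 size_rcons ltnS lw h // ol => /(_ isT).
by [].
Qed.

Definition avoiding_all J T := foldr (fun t J' => avoiding J' t) J T.

Lemma avoiding_all_sub J T i s : avoiding_all J T i s -> J i s.
Proof. by elim: T i s => //= t T IHT i s [/IHT]. Qed.

Lemma avoiding_all_local J (T : seq (nat * seq nat)) : local_family J ->
  (forall t, t \in T -> size t.2 = p) -> local_family (avoiding_all J T).
Proof.
move=> Jl; elim: T => //= t T IHT Tp; apply: avoiding_local; last by apply: Tp; rewrite mem_head.
by apply: IHT => u uT; apply: Tp; rewrite inE uT orbT.
Qed.

(* The states of [T] are put back one at a time: the prime loops at each of them have
   total weight less than 1 at [x], hence also slightly beyond [x] by convexity. *)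
Lemma bsum_avoiding_all_gap J (x : R) (T : seq (nat * seq nat)) : 0 < x -> local_family J ->
  (forall t, t \in T -> size t.2 = p) ->
  (forall t, size t.2 = p -> exists M, bsum (loop J t) (pw x) M) ->
  (exists y M, x < y < 1 /\ bsum (somewhere (avoiding_all J T)) (pw y) M) ->
  exists y M, x < y < 1 /\ bsum (somewhere J) (pw y) M.
Proof.
move=> x0 Jl; elim: T => [|t T IHT] Tp bl //= [y [M [/andP[xy y1] bM]]].
have tp : size t.2 = p by apply: Tp; rewrite mem_head.
have Tp' (u : nat * seq nat) : u \in T -> size u.2 = p.
  by move=> uT; apply: Tp; rewrite inE uT orbT.
have Jl' := avoiding_all_local Jl Tp'; apply: IHT => //.
have y0 : 0 < y by lra.
have [M1 bM1] := bl t tp.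
have bM1' : bsum (loop (avoiding_all J T) t) (pw x) M1.
  by apply: bsum_sub bM1 => w [/avoiding_all_sub].
have [q q1 bq] := bsum_prime_lt1 (pw_mult x0) Jl' tp bM1'.
have bP := bsum_prime_avoiding (introT andP (conj y0 y1)) Jl' tp bM.
have [z [q' [/andP[xz zy] q'1 bz]]] := bsum_interpolate x0 xy q1 bq bP.
have z0 : 0 < z by lra.
have bMz : bsum (somewhere (avoiding (avoiding_all J T) t)) (pw z) M.
  by apply: bsum_le bM => // s _; apply: pw_le; lra.
have [M' bM'] := bsum_eliminate (pw_mult z0) Jl' tp bMz bz q'1.
by exists z, M'; split=> //; apply/andP; split; lra.
Qed.

End LocalLanguages.

(** * The spectral gap *)

Section PositiveWords.
Variable R : realType.
Implicit Types (x y d : R).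

Lemma expr_small x d : 0 <= x < 1 -> 0 < d ->
  exists N, forall n, (N <= n)%N -> x ^+ n < d.
Proof.
move=> /andP[x0 x1] d0; have x1' : `|x| < 1 by rewrite ger0_norm.
have /cvgrPdist_lt h := cvg_expr x1'; have [N _ {}h] := h d d0.
by exists N => n /h /=; rewrite sub0r normrN ger0_norm // exprn_ge0.
Qed.

Lemma bsum_short x n : 0 < x < 1 ->
  exists M, bsum (fun w => all (leq 1) w /\ (size w <= n)%N) (pw x) M.
Proof.
move=> /andP[x0 x1]; have x01 : 0 <= x < 1 by rewrite ltW.
elim: n => [|n [M bM]].
  exists (pw x [::]); apply: bsum_sub (bsum1 (t := [::]) (ltW (pw_gt0 _ x0))) => w [_].
  by rewrite leqn0 size_eq0 => /eqP.
exists (pw x [::] + x ^+ 0 / (1 - x) * M).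
apply: bsumU (bsum1 (t := [::]) (ltW (pw_gt0 _ x0)))
  (bsum_cat (pw_mult x0) (bsum_letter (K := 0) x01) bM).
move=> [|a w] [/= aw sw]; [by left | right].
by exists [:: a], w; split=> //; [exists a | case/andP: aw].
Qed.

(** There are 2^(n-1) compositions of n, and 2^(n-1) / 3^n summed over n >= 1 is 1. This provides a
    point at which the prime loops weigh at most 1, hence r >= 1/3. *)
Lemma bsum_positive :
  bsum (fun w => all (leq 1) w /\ w != [::]) (pw (3^-1 : R)) 1.
Proof.
have x0 : 0 < 3^-1 :> R by rewrite invr_gt0.
have x01 : 0 <= (3^-1 : R) < 1 by rewrite ltW //= invf_lt1 ?ltr1n.
have h1 := bsum_letter (K := 1) x01.
have e : 3^-1 ^+ 1 / (1 - 3^-1) = 2^-1 :> R by rewrite expr1; field.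
rewrite e in h1.
have q1 : 2^-1 < 1 :> R by rewrite invf_lt1 ?ltr1n.
have b1 : bsum (fun w => all (leq 1) w) (pw (3^-1 : R)) (pw (3^-1 : R) [::] / (1 - 2^-1)).
  apply: bsum_star (pw_mult x0) q1 _ (bsum1 (t := [::]) (ltW (pw_gt0 _ x0))) h1.
  move=> [|a w] /= aw; [by left | right].
  by exists [:: a], w; case/andP: aw => a1 aw; split=> //; exists a.
have e1 : 2^-1 * (pw (3^-1 : R) [::] / (1 - 2^-1)) = 1 :> R.
  by rewrite /pw expr0; field.
have := bsum_cat (pw_mult x0) h1 b1; rewrite e1; apply: bsum_sub => -[|a w] [/= aw //] _.
by exists [:: a], w; case/andP: aw => a1 aw; split=> //; exists a.
Qed.

End PositiveWords.

Section SmallBlocks.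
Variables (R : realType) (m p : nat).
Hypotheses (m0 : (0 < m)%N) (p0 : (0 < p)%N).
Implicit Types (J : nat -> seq nat -> Prop) (t : nat * seq nat).

Lemma avoiding_all_occ J (T : seq (nat * seq nat)) t i s l :
  avoiding_all m J T i s -> t \in T -> ~~ occ m t i s l.
Proof.
elim: T => //= u T IHT [/IHT h av]; rewrite inE => /orP[/eqP->|/h//].
exact: av.
Qed.

Definition small_states K : seq (nat * seq nat) :=
  [seq (i, b) | i <- iota 0 m, b <- [seq map (@nat_of_ord K) c | c : p.-tuple 'I_K]].

Lemma small_states_size K t : t \in small_states K -> size t.2 = p.
Proof. by case/allpairsP => -[i b] /= [_ /mapP[c _ ->] ->] /=; rewrite size_map size_tuple. Qed.

Lemma small_states_mem K i (b : seq nat) : size b = p -> all (gtn K) b ->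
  ((i %% m)%N, b) \in small_states K.
Proof.
move=> bp bK; apply: (allpairs_f pair); first by rewrite mem_iota /= add0n ltn_pmod.
have sb : size (pmap insub b : seq 'I_K) == p.
  by rewrite size_pmap_sub -bp; move: bK; rewrite all_count.
apply/mapP; exists (Tuple sb); rewrite ?mem_enum //=.
elim: (b) bK => //= a c IHc /andP[aK cK].
by rewrite insubT /= -IHc.
Qed.

(* In a word avoiding all small states every block of [p] parts has a part at least
   [K], so that for large [K] the blocks have total weight less than 1. *)
Lemma bsum_avoiding_small J (y : R) : local_family m p J -> 0 < y < 1 ->
  exists K M, bsum (somewhere (avoiding_all m J (small_states K))) (pw y) M.
Proof.
move=> Jl /[dup] y01 /andP[y0 y1]; have [G bG] := bsum_short p y01.
have G0 := bsum_ge0 bG; have y01' : 0 <= y < 1 by rewrite ltW.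
(* [G] bounds the short words on either side of one part at least [K]; this threshold makes G^2 y^K
   / (1 - y) less than 1/2. *)
have d0 : 0 < (1 - y) / (2 * (G * G + 1)) by apply: divr_gt0; nra.
have [K /(_ _ (leqnn K)) yK] := expr_small y01' d0.
exists K; set q := G * (y ^+ K / (1 - y) * G).
have q1 : q < 1.
  have -> : q = y ^+ K / (1 - y) * (G * G) by rewrite /q; ring.
  have h : y ^+ K / (1 - y) < (2 * (G * G + 1))^-1.
    by rewrite ltr_pdivrMr; [rewrite mulrC | lra].
  have GG : 0 <= G * G by nra.
  apply: (@le_lt_trans _ _ ((2 * (G * G + 1))^-1 * (G * G))).
    by apply: ler_wpM2r => //; exact: ltW.
  by rewrite mulrC ltr_pdivrMr; lra.
exists (G / (1 - q)).
have bB := bsum_cat (pw_mult y0) bG (bsum_cat (pw_mult y0) (bsum_letter (K := K) y01') bG).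
apply: bsum_star (pw_mult y0) q1 _ bG bB => w [i Jw].
have Jl' := avoiding_all_local p0 Jl (@small_states_size K).
have wp : all (leq 1) w by have [_ _ _ /(_ _ _ Jw)] := Jl'.
have [sw|sw] := leqP (size w) p; [by left | right].
exists (take p w), (drop p w); rewrite cat_take_drop.
have st : size (take p w) = p by rewrite size_takel // ltnW.
split=> //; first by rewrite -size_eq0 st -lt0n.
  have /allPn[a aw] : ~~ all (gtn K) (take p w).
    apply/negP => /(small_states_mem i st) h; have := avoiding_all_occ 0 Jw h.
    by rewrite /occ /= drop0 addn0 -{2}(cat_take_drop p w) prefix_prefix modn_mod eqxx.
  rewrite /= -leqNgt => Ka.
  have pos : all (leq 1) (take p w).
    by move: wp; rewrite -{1}(cat_take_drop p w) all_cat => /andP[].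
  case/splitPr: aw st pos => u v; rewrite size_cat all_cat /= => st /and3P[pu _ pv].
  exists u, ([:: a] ++ v); split=> //; first by split=> //; lia.
  by exists [:: a], v; split=> //; [exists a | split=> //; lia].
exists (i + p)%N; move: Jw; rewrite -{1}(cat_take_drop p w) => Jw.
by apply: (local_right Jl' Jw); rewrite st.
Qed.

End SmallBlocks.

Section Irreducible.
Variables (R : realType) (m p : nat).
Hypotheses (m0 : (0 < m)%N) (p0 : (0 < p)%N).
Variable I : nat -> seq nat -> Prop.
Hypothesis Il : local_family m p I.
Hypothesis Iconn : forall i j s u, I i s -> I j u -> u != [::] ->
  exists2 y, I i (s ++ y ++ u) & (i + size s + size y = j %[mod m])%N.
Hypothesis Ifree : forall j l r, size l = p -> size r = p ->
  (forall N, exists2 x, (N <= x)%N & I j (l ++ x :: r)) ->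
  exists M, forall x, (M <= x)%N -> I j (l ++ x :: r).
Implicit Types (s t : nat * seq nat).

Definition minimal_walk t t' v : Prop :=
  [/\ walk m I t t' v,
      forall k, (k < size v)%N -> ~~ occ m t' t.1 (t.2 ++ v) k
    & forall k, (0 < k)%N -> ~~ occ m t t.1 (t.2 ++ v) k].

(** A walk of least length works: an earlier visit to [t'] or a later return to [t] would leave a
    shorter walk. *)
Lemma minimal_walk_exists t t' : size t.2 = p -> size t'.2 = p ->
  I t.1 t.2 -> I t'.1 t'.2 -> exists v, minimal_walk t t' v.
Proof.
move=> tp tp' It It'.
have t'0 : t'.2 != [::] by rewrite -size_eq0 tp' -lt0n.
have ex : exists n, `[< exists2 v, size v = n & walk m I t t' v >].
  have [y yI yj] := Iconn It It' t'0.
  exists (size (y ++ t'.2)); apply/asboolP; exists (y ++ t'.2) => //; split=> //.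
  have -> : size (y ++ t'.2) = (size t.2 + size y)%N by rewrite size_cat tp tp' addnC.
  by rewrite occ_catl -[size y]addn0 occ_catl /occ drop0 prefix_refl addn0 yj eqxx.
case: (ex_minnP ex) => n /asboolP[v vn wv] nmin; exists v.
have [Iv ov] := wv; split=> // k => [kv|k1]; apply/negP => ok.
  suff /nmin : `[< exists2 v, size v = k & walk m I t t' v >].
    by rewrite -vn; move: kv; clear; lia.
  apply/asboolP; exists (take k v); first by rewrite size_takel // ltnW.
  split; first by move: Iv; rewrite -{1}(cat_take_drop k v) catA; exact: (local_left Il).
  rewrite size_takel 1?ltnW //; move: ok; rewrite -{1}(cat_take_drop k v) (@occ_walkl _ p) //.
  by rewrite size_takel // ltnW.
have kv : (k <= size v)%N by have := occ_bound p0 tp ok; rewrite size_cat tp; lia.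
have [E sE] := occP p0 tp ok.
have dE : drop (k + p) (t.2 ++ v) = drop k v by rewrite -drop_drop -tp drop_size_cat.
rewrite dE in E.
suff /nmin : `[< exists2 v', size v' = (size v - k)%N & walk m I t t' v' >] by lia.
have mk : (t.1 + k = t.1 %[mod m])%N by case/andP: ok => _ /eqP.
apply/asboolP; exists (drop k v); first by rewrite size_drop.
split; first by rewrite E in Iv; apply: (local_right Il Iv); rewrite sE.
move: ov; rewrite E size_drop; have -> : size v = (size (take k (t.2 ++ v)) + (size v - k))%N.
  by rewrite sE subnKC.
by rewrite occ_catl sE addKn (occ_mod _ _ _ mk).
Qed.

(* Loops at [t] avoiding [s] embed into the prime loops at [s]: precede them by a
   shortest walk from [s] to [t] and follow them by a shortest walk back. *)
Lemma bsum_avoiding_loops s t (x M : R) : 0 < x -> size s.2 = p -> size t.2 = p ->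
  I s.1 s.2 -> bsum (prime_loop m I s) (pw x) M ->
  exists M', bsum (loop m (avoiding m I s) t) (pw x) M'.
Proof.
move=> x0 sp tp Is bM.
have [/asboolP [It avt]|/asboolPn nJ] := boolP `[< avoiding m I s t.1 t.2 >]; last first.
  exists 0; apply: bsum0 => w [Jw _]; apply: nJ.
  exact: local_left (avoiding_local p0 Il sp) Jw.
have [v [wv _ v_av]] := minimal_walk_exists sp tp Is It.
have [v' [wv' v_av' _]] := minimal_walk_exists tp sp It Is.
(* The block of [t] avoids [s], so the walk back to [s] cannot be empty. *)
have v'0 : (0 < size v')%N.
  rewrite lt0n size_eq0; apply/eqP => v'0; move: wv'; rewrite v'0 => -[_].
  by rewrite cats0 (negbTE (avt 0)).
exists ((pw x v * pw x v')^-1 * M).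
have gt0 := pw_gt0 _ x0.
have [_ gM _] := pw_mult x0.
apply: (@bsum_inj _ _ _ (fun w => v ++ w ++ v') _ (prime_loop m I s)
  (fun w => (pw x v * pw x v')^-1 * pw x w));
  last by apply: bsumZ; rewrite // invr_ge0 mulr_ge0 ?ltW.
- apply: (can_inj (g := fun w => drop (size v) (take (size w - size v') w))) => w.
  by rewrite catA size_cat addnK take_size_cat // drop_size_cat.
- move=> w [[Iw avw] ow]; have lw : loop m I t w by [].
  split.
  + exact: walk_cat Il sp tp wv (walk_cat p0 Il tp tp lw wv').
  + by rewrite -size_eq0 -lt0n !size_cat !addn_gt0 v'0 !orbT.
  move=> k /andP[k0 kl]; have [kv|kv] := leqP k (size v).
    by rewrite (@occ_walkl _ p) // v_av.
  rewrite -(subnKC (ltnW kv)) (occ_walkr p0 _ _ _ sp tp wv).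
  move: (k - size v)%N (subnKC (ltnW kv)) => k' kE.
  have [kw|kw] := leqP k' (size w); first by rewrite (@occ_walkl _ p) // avw.
  rewrite -(subnKC (ltnW kw)) (occ_walkr p0 _ _ _ tp tp lw) v_av' //.
  move: kl; rewrite !size_cat -kE ltn_add2l -{1}(subnKC (ltnW kw)).
  by rewrite ltn_add2l.
- move=> w _; rewrite !gM -[leLHS]mul1r [leRHS]mulrC.
  rewrite ler_pdivlMr ?mulr_gt0 // mul1r; lra.
Qed.

(** The prime-loop sum at [x] bounds, at every state, the loops avoiding [s]. This is what restoring
    the small states one at a time requires, so convergence beyond [x] survives each restoration. *)
Lemma bsum_avoiding_gap s (x M : R) : 0 < x < 1 -> size s.2 = p -> I s.1 s.2 ->
  bsum (prime_loop m I s) (pw x) M ->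
  exists y M', x < y < 1 /\ bsum (somewhere (avoiding m I s)) (pw y) M'.
Proof.
move=> /andP[x0 x1] sp Is bM; have Jl := avoiding_local p0 Il sp.
have y01 : 0 < (x + 1) / 2 < 1 by apply/andP; split; lra.
have [K [M1 bM1]] := bsum_avoiding_small m0 p0 Jl y01.
apply: (bsum_avoiding_all_gap p0 x0 Jl (@small_states_size m p K)).
  by move=> t tp; exact: bsum_avoiding_loops x0 sp tp Is bM.
by exists ((x + 1) / 2), M1; split=> //; apply/andP; split; lra.
Qed.

Section FreeState.
Variables (j : nat) (l r : seq nat).
Hypotheses (lp : size l = p) (rp : size r = p).
Hypothesis jfree : forall N, exists2 x, (N <= x)%N & I j (l ++ x :: r).

(** The free part sits at residue j + p, so this is the state right after it: the [p] parts of [r],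
    starting at j + p + 1. *)
Definition free_state : nat * seq nat := ((j + p.+1)%N, r).

Lemma free_state_in : I free_state.1 free_state.2.
Proof.
have [x _] := jfree 0; rewrite -cat1s catA => h.
by apply: (local_right Il h); rewrite size_cat lp addn1.
Qed.

(** To a shortest walk from [r] to [l] append the part [x] and the block [r]. An early return either
    lies on the shortest walk, which excludes it, or covers [x], which is impossible once [x]
    exceeds all parts of [r]. *)
Lemma free_prime_loops : exists v M, forall x, (M <= x)%N ->
  prime_loop m I free_state (v ++ x :: r).
Proof.
have Il0 : I j l by have [x _ h] := jfree 0; exact: (local_left Il h).
have [v [wv _ v_av]] := minimal_walk_exists (t := free_state) (t' := (j, l))
  rp lp free_state_in Il0.
have [M hM] := Ifree lp rp jfree.
exists v, (maxn M (\max_(a <- r) a).+1) => x; rewrite geq_max => /andP[Mx rx].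
have wx : walk m I (j, l) free_state (x :: r).
  split; first exact: hM.
  have -> : size (x :: r) = (size l + 1)%N by rewrite /= rp lp addn1.
  by rewrite occ_catl /occ /= drop0 prefix_refl lp -addnA addn1 eqxx.
split.
- exact: (walk_cat p0 Il (t := free_state) (t' := (j, l)) rp lp wv wx).
- by rewrite -size_eq0 size_cat /= addnS.
move=> k /andP[k0 kl]; have [kv|kv] := leqP k (size v).
  by rewrite (@occ_walkl _ p) // v_av.
rewrite -(subnKC (ltnW kv)) (occ_walkr p0 (t := free_state) (t' := (j, l)) _ _ _ rp lp wv).
apply/negP => /(occ_nth (n := size l) (t := free_state) p0 rp).
move: kl; rewrite nth_cat ltnn subnn size_cat /= rp lp => kl.
have -> : (k - size v <= p < k - size v + p)%N by lia.
move=> /(_ isT) xr; have : (x <= \max_(a <- r) a)%N by exact: leq_bigmax_seq.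
by rewrite leqNgt rx.
Qed.

End FreeState.

End Irreducible.

(** * The radius as the point where the prime loops reach total weight 1 *)

Section Radius.
Variable R : realType.
Variable P : seq nat -> Prop.
Hypothesis P_pos : forall w, P w -> all (leq 1) w /\ w != [::].

Lemma bernoulli_le (c : R) n : 0 <= c <= 1 -> 1 - n%:R * c <= (1 - c) ^+ n.
Proof.
move=> /andP[c0 c1]; elim: n => [|n IHn]; first by rewrite expr0 mul0r subr0.
rewrite exprS -natr1; have n0 : 0 <= n%:R :> R by [].
have h : (1 - c) * (1 - n%:R * c) <= (1 - c) * (1 - c) ^+ n.
  by rewrite ler_wpM2l // subr_ge0.
apply: le_trans h; nra.
Qed.

(* [r] is the supremum of the [x] at which the total weight of [P] is at most 1; the
   two words of [P] force [r < 1]. *)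
Lemma radius_exists w w' : P w -> P w' -> w != w' ->
  exists r : R, [/\ 0 < r < 1, bsum P (pw r) 1
    & forall y, r < y < 1 ->
        exists l, [/\ uniq l, forall t, t \in l -> P t & 1 < \sum_(t <- l) pw y t]].
Proof.
move=> Pw Pw' ww'.
pose S : set R := (fun x => 0 < x < 1 /\ bsum P (pw x) 1).
have S3 : S 3^-1.
  split; last by apply: bsum_sub (bsum_positive R) => t /P_pos.
  by rewrite invr_gt0 invf_lt1 ?ltr1n ?ltr0n.
(* [c] is so small that (1 - c)^s > 1/2: beyond 1 - c the words [w] and [w'] alone weigh more than
   1. *)
pose s := (sumn w + sumn w')%N; pose c : R := (2 * s.+1%:R)^-1.
have c0 : 0 < c by rewrite invr_gt0 mulr_gt0.
have cE : c * (2 * s.+1%:R) = 1 by rewrite mulVf // gt_eqF // mulr_gt0.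
have s0 : 1 <= s.+1%:R :> R by rewrite ler1n.
have c1 : c <= 1 by nra.
have Sub : ubound S (1 - c).
  move=> x [/andP[x0 x1] bx]; rewrite leNgt; apply/negP => cx.
  have := bx [:: w; w']; rewrite big_cons big_seq1 => bxw.
  have h t : (sumn t <= s)%N -> 1 - s%:R * c <= pw x t.
    move=> ts; apply: le_trans (_ : (1 - c) ^+ sumn t <= _).
      apply: le_trans (bernoulli_le (sumn t) _); last by apply/andP; split; lra.
      by rewrite lerD2l lerN2 ler_wpM2r ?ler_nat // ltW.
    by apply: pw_le; lra.
  have := h w (leq_addr _ _); have := h w' (leq_addl _ _).
  move: cE; rewrite -natr1 => cE h1 h2.
  have : pw x w + pw x w' <= 1.
    apply: bxw; first by rewrite /= inE ww'.
    by move=> t; rewrite !inE => /orP[]/eqP->.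
  nra.
have supS : has_sup S by split; [exists 3^-1 | exists (1 - c)].
have r3 : 3^-1 <= sup S by apply: sup_upper_bound.
have r1 : sup S <= 1 - c by apply: ge_sup; first by exists 3^-1.
have i3 : 0 < 3^-1 :> R by rewrite invr_gt0.
exists (sup S); split; first by apply/andP; split; lra.
  move=> l ul lP; set r := sup S in r3 r1 *; set T := \sum_(t <- l) pw r t.
  rewrite leNgt; apply/negP => T1.
  pose N := (\max_(t <- l) sumn t)%N.
  (* By Bernoulli's inequality a finite list exceeding 1 at [r] still exceeds 1 at (1 - d) r, but
     some point of [S] lies beyond that. *)
  pose d := (T - 1) / (2 * (N%:R + 1) * T).
  have N0 : 0 <= N%:R :> R by [].
  have D0 : 0 < 2 * (N%:R + 1) * T by rewrite !mulr_gt0; lra.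
  have d0 : 0 < d by rewrite divr_gt0 // subr_gt0.
  have dE : d * (2 * (N%:R + 1) * T) = T - 1 by rewrite mulfVK // gt_eqF.
  have d1 : d <= 1 by rewrite ler_pdivrMr //; nra.
  have dr0 : 0 < d * r by apply: mulr_gt0; lra.
  have [x [/andP[x0 x1] bx] rx] := sup_adherent dr0 supS; rewrite -/r in rx.
  have : (1 - N%:R * d) * T <= 1.
    apply: le_trans (bx l ul lP); rewrite big_distrr /= big_seq [leRHS]big_seq.
    apply: ler_sum => t tl; apply: (@le_trans _ _ (pw ((1 - d) * r) t)); last first.
      by apply: pw_le; nra.
    rewrite /pw exprMn ler_wpM2r ?exprn_ge0 //; first by lra.
    apply: le_trans (bernoulli_le (sumn t) _); last by apply/andP; split; lra.
    rewrite lerD2l lerN2 ler_wpM2r ?ler_nat //; first by lra.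
    exact: leq_bigmax_seq.
  nra.
move=> y /andP[ry y1]; apply: contrapT => H.
suff : y <= sup S by lra.
apply: sup_upper_bound => //; split; first by apply/andP; split; lra.
move=> l ul lP; rewrite leNgt; apply/negP => h; apply: H.
by exists l.
Qed.

End Radius.

(** * Growth and concentration *)

Section Growth.
Variable R : realType.
Variables P L : seq nat -> Prop.
Hypothesis P_pos : forall w, P w -> all (leq 1) w /\ w != [::].
Hypothesis PL : forall u v, P u -> L v -> L (u ++ v).
Hypothesis P_inj : forall u v u' v', P u -> P u' -> u ++ v = u' ++ v' -> u = u'.

Lemma sumn_gt0 (w : seq nat) : all (leq 1) w -> w != [::] -> (0 < sumn w)%N.
Proof. by case: w => //= a w /andP[a1 _] _; rewrite addn_gt0 a1. Qed.

(** A renewal inequality. Prefixing the words of [l0] is injective, so the counts satisfy a_n >= sum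
    of a_(n - |t|) over [l0]. As [l0] weighs at least 1 at [x], a lower bound on x^n a_n for n from
    n0 to n0 + s propagates to all larger n; in that window one word per sum is enough. *)
Lemma growth_lower (x : R) (l0 : seq (seq nat)) n0 : 0 < x < 1 ->
  uniq l0 -> (forall t, t \in l0 -> P t) -> 1 <= \sum_(t <- l0) pw x t ->
  (forall n, (n0 <= n)%N -> exists2 w, L w & sumn w = n) ->
  exists2 c, 0 < c & forall n, (n0 <= n)%N -> exists l,
    [/\ uniq l, forall t, t \in l -> L t /\ sumn t = n & c <= x ^+ n * (size l)%:R].
Proof.
move=> /andP[x0 x1] ul0 l0P l0x Ln; pose s := (\max_(t <- l0) sumn t)%N.
exists (x ^+ (n0 + s)); first exact: exprn_gt0.
elim/ltn_ind => n IHn n0n; have [ns|ns] := leqP n (n0 + s).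
  have [w Lw wn] := Ln n n0n; exists [:: w]; split=> //.
    by move=> t; rewrite inE => /eqP->.
  by rewrite mulr1 ler_wiXn2l // ltW.
have /choice[f hf] k : exists l : seq (seq nat), (n0 <= k < n)%N ->
    [/\ uniq l, forall t, t \in l -> L t /\ sumn t = k & x ^+ (n0 + s) <= x ^+ k * (size l)%:R].
  have [/andP[n0k kn]|h] := boolP (n0 <= k < n)%N; last by exists [::].
  by have [l hl] := IHn k kn n0k; exists l.
have hs t : t \in l0 -> (n0 <= n - sumn t < n)%N /\ (sumn t <= n)%N.
  move=> tl; have ts : (sumn t <= s)%N by exact: leq_bigmax_seq.
  by have [/sumn_gt0 h /h] := P_pos (l0P _ tl); lia.
exists [seq u ++ v | u <- l0, v <- f (n - sumn u)%N]; split.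
- apply: allpairs_uniq_dep => // [u ul|]; first by have [/hf[]] := hs u ul.
  move=> _ _ /allpairsPdep[u [v [ul vf ->]]] /allpairsPdep[u' [v' [ul' vf' ->]]] /= e.
  have uu := P_inj (l0P _ ul) (l0P _ ul') e; move: e; rewrite uu => /eqP.
  by rewrite eqseq_cat // eqxx => /eqP->.
- move=> _ /allpairsPdep[u [v [ul vf ->]]]; have [h1 h2] := hs u ul.
  have [_ /(_ _ vf)[Lv vn] _] := hf _ h1; split; first exact: PL (l0P _ ul) Lv.
  by rewrite sumn_cat vn subnKC.
rewrite size_allpairs_dep sumnE big_map natr_sum big_distrr /=.
rewrite -[leLHS]mul1r; apply: (@le_trans _ _ ((\sum_(t <- l0) pw x t) * x ^+ (n0 + s))).
  by rewrite ler_wpM2r // exprn_ge0 // ltW.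
rewrite big_distrl /= big_seq [leRHS]big_seq; apply: ler_sum => t tl.
have [h1 h2] := hs t tl; have [_ _ h3] := hf _ h1.
have -> : x ^+ n = x ^+ sumn t * x ^+ (n - sumn t) by rewrite -exprD subnKC.
by rewrite -mulrA ler_wpM2l // exprn_ge0 // ltW.
Qed.

End Growth.

Section Tilt.
Variable R : realType.
Implicit Types (Y : seq nat -> R) (x y K : R).

Lemma expR_le_quadratic y : expR y <= 1 + y + y ^+ 2 * expR `|y|.
Proof.
have e0 := expR_gt0 y.
have h : expR y - 1 <= y * expR y.
  have := expR_ge1Dx (- y); rewrite expRN => h.
  have : (1 - y) * expR y <= 1.
    by apply: le_trans (ler_wpM2r (ltW e0) h) _; rewrite mulVf // gt_eqF.
  lra.
have ey : expR y <= expR `|y| by rewrite ler_expR ler_norm.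
have e1 : 1 <= expR `|y| by rewrite -expR0 ler_expR.
have y2 : 0 <= y ^+ 2 by rewrite sqr_ge0.
have : y * (expR y - 1) <= y ^+ 2 * expR `|y|.
  have [y0|/ltW y0] := leP 0 y.
    apply: (@le_trans _ _ (y * (y * expR y))); first exact: ler_wpM2l.
    by rewrite mulrA -expr2; exact: ler_wpM2l.
  have := expR_ge1Dx y; move: (expR `|y|) e1 => E e1 h'.
  have : y ^+ 2 <= y ^+ 2 * E by rewrite ler_peMr.
  by rewrite expr2; nra.
lra.
Qed.

Lemma sqr_le_expR y : 0 <= y -> y ^+ 2 <= expR (2 * y).
Proof.
move=> y0; rewrite mulrC expRM_natr lerXn2r ?nnegrE ?expR_ge0 //.
by have := expR_ge1Dx y; lra.
Qed.

Definition additive_stat Y K : Prop :=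
  [/\ Y [::] = 0, forall u v, Y (u ++ v) = Y u + Y v
    & forall u, all (leq 1) u -> `|Y u| <= K * (sumn u)%:R].

Definition tilt x t Y w : R := pw x w * expR (t * Y w).

Lemma tilt_mul x t Y K : 0 < x -> additive_stat Y K -> word_weight (tilt x t Y).
Proof.
move=> x0 [Y0 YM _]; have [w1 wM wp] := pw_mult x0; rewrite /tilt; split.
- by rewrite w1 Y0 mulr0 expR0 mulr1.
- by move=> u v; rewrite wM YM mulrDr expRD mulrACA.
- by move=> u; rewrite mulr_gt0 // expR_gt0.
Qed.

(** As [|Y w|] is at most [K] times the sum, tilting costs at most a factor [expR (t * K)] per unit
    of sum. *)
Lemma tilt_le x y t Y K w : 0 < x -> 0 <= t -> additive_stat Y K ->
  x * expR (t * K) <= y -> all (leq 1) w -> tilt x t Y w <= pw y w.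
Proof.
move=> x0 t0 [_ _ YK] xy wp; apply: (@le_trans _ _ (pw (x * expR (t * K)) w)); last first.
  by apply: pw_le => //; rewrite mulr_ge0 ?expR_ge0 // ltW.
rewrite /tilt /pw exprMn; apply: ler_wpM2l; first by rewrite exprn_ge0 // ltW.
rewrite -expRM_natr ler_expR -mulrA.
by apply: ler_wpM2l => //; apply: le_trans (YK w wp); exact: ler_norm.
Qed.

(* To first order in [t], the tilted sum over [P] is [1 + t * (sum of x^|w| Y w)], which
   is less than 1 when [Y] has negative mean. *)
Lemma bsum_tilt (P : seq nat -> Prop) x y M Y K (l0 : seq (seq nat)) e :
  0 < x < y -> 0 < K -> additive_stat Y K ->
  (forall w, P w -> all (leq 1) w) ->
  bsum P (pw x) 1 -> bsum P (pw y) M ->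
  0 < e -> uniq l0 -> (forall t, t \in l0 -> P t) ->
  (forall l, uniq l -> (forall t, t \in l -> P t) -> {subset l0 <= l} ->
    \sum_(w <- l) pw x w * Y w <= - e) ->
  exists t q, [/\ 0 < t, x * expR (t * K) <= y, q < 1 & bsum P (tilt x t Y) q].
Proof.
move=> /andP[x0 xy] K0 Ya P_pos b1 bM e0 ul0 l0P l0Y.
have M0 := bsum_ge0 bM; have [Y0 YM YK] := Ya.
(* Going from [x] to [y] gains exactly [expR (3 * t0 * K)] per unit of sum: two of the three shares
   absorb the square of [t * Y w], the third its exponential. *)
pose t0 := ln (y / x) / (3 * K).
have yx : 1 < y / x by rewrite ltr_pdivlMr // mul1r.
have t00 : 0 < t0 by rewrite divr_gt0 ?ln_gt0 ?mulr_gt0.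
have t0E : expR (3 * t0 * K) = y / x.
  have -> : 3 * t0 * K = ln (y / x) by rewrite /t0; field; rewrite gt_eqF.
  by rewrite lnK // posrE; lra.
pose D := M / t0 ^+ 2; have D0 : 0 <= D by rewrite divr_ge0 // sqr_ge0.
(* The second term of the minimum keeps the quadratic error t^2 D at most t e / 2, half of the
   linear gain. *)
pose t := Num.min t0 (e / (2 * (D + 1))).
have D1 : 0 < 2 * (D + 1) by lra.
have tp : 0 < t by rewrite lt_min t00 divr_gt0.
have tt0 : t <= t0 by rewrite ge_min lexx.
have tD : t * (2 * (D + 1)) <= e by rewrite -ler_pdivlMr // ge_min lexx orbT.
exists t, (1 - t * e / 2); split=> //.
- rewrite mulrC -ler_pdivlMr // -t0E ler_expR; apply: ler_wpM2r; [exact: ltW | lra].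
- by have := mulr_gt0 tp e0; lra.
apply: (bsum_ext _ ul0 l0P) => [w _|l ul lP l0l].
  by rewrite mulr_ge0 ?expR_ge0 // exprn_ge0 // ltW.
have h w : w \in l ->
    tilt x t Y w <= pw x w + t * (pw x w * Y w) + (t / t0) ^+ 2 * pw y w.
  move=> /lP /P_pos /YK; set s := (sumn w)%:R => Yw.
  have s0 : 0 <= s by rewrite ler0n.
  have Ks : 0 <= t0 * (K * s) by rewrite (mulr_ge0 (ltW t00)) // mulr_ge0 // ltW.
  have tY : `|t * Y w| <= (t / t0) * (t0 * (K * s)).
    have -> : (t / t0) * (t0 * (K * s)) = t * (K * s) by field; rewrite gt_eqF.
    by rewrite normrM gtr0_norm // ler_wpM2l // ltW.
  have tt1 : 0 <= t / t0 <= 1 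
    by rewrite (divr_ge0 (ltW tp) (ltW t00)) /= ler_pdivrMr // mul1r.
  have : (t * Y w) ^+ 2 * expR `|t * Y w| <= (t / t0) ^+ 2 * (y / x) ^+ sumn w.
    have -> : (y / x) ^+ sumn w = expR (2 * (t0 * (K * s))) * expR (t0 * (K * s)).
      rewrite -expRD -t0E -expRM_natr; congr expR; rewrite -/s; ring.
    rewrite [leRHS]mulrA; apply: ler_pM; rewrite ?sqr_ge0 ?expR_ge0 //.
      apply: (@le_trans _ _ ((t / t0) ^+ 2 * (t0 * (K * s)) ^+ 2)).
        by rewrite -exprMn -[leLHS]real_normK ?num_real // lerXn2r ?nnegrE // mulr_ge0 //; lra.
      by rewrite ler_wpM2l ?sqr_ge0 // sqr_le_expR.
    rewrite ler_expR; apply: le_trans tY _; rewrite -[leRHS]mul1r ler_wpM2r //; lra.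
  have := expR_le_quadratic (t * Y w); set E := expR _; set Q := _ * expR _ => h1 h2.
  have xs : 0 < pw x w by exact: pw_gt0.
  have -> : pw y w = pw x w * (y / x) ^+ sumn w.
    by rewrite /pw -exprMn mulrC mulfVK // gt_eqF.
  rewrite /tilt -/E.
  apply: (@le_trans _ _ (pw x w * (1 + t * Y w + (t / t0) ^+ 2 * (y / x) ^+ sumn w))).
    apply: ler_wpM2l; [exact: ltW | lra].
  by rewrite le_eqVlt; apply/orP; left; apply/eqP; ring.
apply: (@le_trans _ _ (\sum_(w <- l) (pw x w + t * (pw x w * Y w) + (t / t0) ^+ 2 * pw y w))).
  by rewrite big_seq [leRHS]big_seq; exact: ler_sum.
rewrite !big_split /= -!big_distrr /=.
have h1 := b1 l ul lP; have h2 := l0Y l ul lP l0l; have h3 := bM l ul lP.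
have h4 : t * \sum_(w <- l) pw x w * Y w <= t * - e by rewrite ler_wpM2l // ltW.
have h5 : (t / t0) ^+ 2 * \sum_(w <- l) pw y w <= t ^+ 2 * D.
  apply: le_trans (ler_wpM2l (sqr_ge0 _) h3) _.
  by rewrite /D expr_div_n -mulrA [t0 ^- 2 * _]mulrC.
have h6 : t ^+ 2 * D <= t * e / 2.
  have : t * (t * (2 * (D + 1))) <= t * e by rewrite ler_wpM2l // ltW.
  have := sqr_ge0 t; rewrite !expr2; nra.
lra.
Qed.

End Tilt.

Section Hull.
Variables (R : realType) (m p : nat).
Hypothesis p0 : (0 < p)%N.
Variable I : nat -> seq nat -> Prop.
Hypothesis Il : local_family m p I.
Variable s : nat * seq nat.
Hypothesis sp : size s.2 = p.
Variables (r y : R).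
Hypotheses (r0 : 0 < r) (ry : r < y) (y1 : y < 1).

Local Notation P := (prime_loop m I s).

Hypothesis P_r : bsum P (pw r) 1.
Hypothesis P_growth : forall x, r < x < 1 ->
  exists l, [/\ uniq l, forall t, t \in l -> P t & 1 < \sum_(t <- l) pw x t].
Hypothesis P_y : exists M, bsum P (pw y) M.
Hypothesis avoiding_y : exists M, bsum (somewhere (avoiding m I s)) (pw y) M.
Hypothesis loop_sums : exists N, forall n, (N <= n)%N ->
  exists2 w, loop m I s w & sumn w = n.

Let y01 : 0 < y < 1. Proof. by rewrite (lt_trans r0 ry). Qed.

(* Contains every class of local restrictions whose interior words are those of [I],
   whatever happens within distance [p] of the two ends. *)
Definition hull (c : seq nat) : Prop :=
  (all (leq 1) c /\ (size c <= p + p)%N) \/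
  exists a u, [/\ c = a ++ u, all (leq 1) a /\ (size a <= p)%N &
    exists b z, [/\ u = b ++ z, somewhere I b & all (leq 1) z /\ (size z <= p)%N]].

Lemma prime_pos w : P w -> all (leq 1) w /\ w != [::].
Proof.
move=> [[Iw _] w0 _]; split=> //; have [_ _ _ /(_ _ _ Iw)] := Il.
by rewrite all_cat => /andP[].
Qed.

Lemma hull_pos c : hull c -> all (leq 1) c.
Proof.
move=> [[]//|[a [u [-> [pa _] [b [z [-> [i Ib] [pz _]]]]]]]].
by rewrite !all_cat pa pz; have [_ _ _ /(_ _ _ Ib) ->] := Il.
Qed.

(** The ends and the words avoiding [s] are dominated by their weight at [y]; the stretch between
    the first and the last visit to [s] is governed by [q]. *)
Lemma bsum_hull g q : word_weight g -> (forall w, all (leq 1) w -> g w <= pw y w) ->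
  bsum P g q -> q < 1 -> exists M, bsum hull g M.
Proof.
move=> gm gy bq q1.
have [M bM] := avoiding_y; have [B bB] := bsum_short p y01.
have [B2 bB2] := bsum_short (p + p) y01.
have [_ _ _ Ip] := Il; have gys (A : seq nat -> Prop) N : (forall w, A w -> all (leq 1) w) ->
  bsum A (pw y) N -> bsum A g N by move=> Ap; apply: bsum_le => // w /Ap /gy.
have bM' : bsum (somewhere (avoiding m I s)) g M by apply: gys bM => w [i [/Ip]].
have [M' bI] := bsum_eliminate p0 gm Il sp bM' bq q1.
have bB' : bsum (fun w => all (leq 1) w /\ (size w <= p)%N) g B by apply: gys bB => w [].
have bB2' : bsum (fun w => all (leq 1) w /\ (size w <= p + p)%N) g B2 by apply: gys bB2 => w [].
exists (B2 + B * (M' * B)).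
by apply: bsumU bB2' (bsum_cat gm bB' (bsum_cat gm bI bB')).
Qed.

Variable F : nat -> seq (seq nat).
Hypothesis F_uniq : forall n, uniq (F n).
Hypothesis F_hull : forall n c, c \in F n -> hull c /\ sumn c = n.
Hypothesis F_loop : exists a z, forall w, loop m I s w -> a ++ w ++ z \in F (sumn (a ++ w ++ z)).

Lemma F_lower x : r < x < 1 ->
  exists2 c, 0 < c & exists N, forall n, (N <= n)%N -> c <= x ^+ n * (size (F n))%:R.
Proof.
move=> /[dup] rx /andP[rx1 x1]; have x0 : 0 < x by exact: lt_trans rx1.
have [l0 [ul0 l0P l0x]] := P_growth rx; have [n0 hn0] := loop_sums.
have PL u v : P u -> loop m I s v -> loop m I s (u ++ v).
  by move=> [lu _ _]; exact: (walk_cat p0 Il sp sp lu).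
have P_inj u v u' v' : P u -> P u' -> u ++ v = u' ++ v' -> u = u'.
  exact: (prime_cat_inj sp).
have x01 : 0 < x < 1 by rewrite x0.
have [c c0 hc] := growth_lower prime_pos PL P_inj x01 ul0 l0P (ltW l0x) hn0.
have [a [z Faz]] := F_loop; pose k := (sumn a + sumn z)%N.
exists (x ^+ k * c); first by rewrite mulr_gt0 // exprn_gt0.
exists (n0 + k)%N => n nk; have kn := leq_trans (leq_addl _ _) nk.
have [|l [ul lL cl]] := hc (n - k)%N; first by rewrite leq_subRL // addnC.
have sl : (size l <= size (F n))%N.
  rewrite -(size_map (fun w => a ++ w ++ z) l); apply: uniq_leq_size.
    rewrite map_inj_uniq //; apply: (can_inj (g := fun w =>
      drop (size a) (take (size w - size z) w))) => w.
    by rewrite catA size_cat addnK take_size_cat // drop_size_cat.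
  move=> _ /mapP[w wl ->]; have [Lw wn] := lL w wl.
  have := Faz w Lw; rewrite !sumn_cat wn.
  by rewrite addnCA subnK.
have -> : x ^+ n = x ^+ k * x ^+ (n - k) by rewrite -exprD subnKC.
rewrite -mulrA; apply: ler_wpM2l; first by rewrite exprn_ge0 // ltW.
apply: le_trans cl _; apply: ler_wpM2l; first by rewrite exprn_ge0 // ltW.
by rewrite ler_nat.
Qed.

Lemma F_unbounded x M : r < x -> exists n, M < (size (F n))%:R * x ^+ n.
Proof.
(* The lower bound at [z], chosen between [r] and [x], is amplified by (x / z)^n. *)
move=> rx; pose z := (r + Num.min 1 x) / 2.
have [rz zx z1] : [/\ r < z, z < x & z < 1].
  have := lt_trans ry y1.
  by rewrite /z; case: (leP 1 x) => ?; split; lra.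
have z0 := lt_trans r0 rz; have x0 := lt_trans r0 rx.
have [|c c0 [N hN]] := @F_lower z; first by rewrite rz.
have M0 : 0 < `|M| + 1 by rewrite ltr_wpDl.
have [||N' hN'] := @expr_small R (z / x) (c / (`|M| + 1)).
- by rewrite (divr_ge0 (ltW z0) (ltW x0)) /= ltr_pdivrMr // mul1r.
- by rewrite divr_gt0.
pose n := maxn N N'; exists n; have := hN n (leq_maxl _ _).
have := hN' n (leq_maxr _ _); rewrite ltr_pdivlMr // => h1 h2.
have h0 : 0 < (z / x) ^+ n by rewrite exprn_gt0 // divr_gt0.
apply: (@lt_trans _ _ (`|M| + 1)); first by rewrite ltr_pwDr // ler_norm.
rewrite -(ltr_pM2l h0); apply: lt_le_trans h1 _; apply: le_trans h2 _.
have -> : z ^+ n = (z / x) ^+ n * x ^+ n by rewrite -exprMn mulfVK // gt_eqF.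
by rewrite -mulrA [x ^+ n * _]mulrC.
Qed.

Lemma F_upper x : 0 < x < r -> exists M, forall n, (size (F n))%:R * x ^+ n <= M.
Proof.
move=> /andP[x0 xr].
(* A prime loop has sum at least 1, so passing from [r] to [x] multiplies its weight by at most x /
   r. *)
have bx : bsum P (pw x) (x / r * 1).
  apply: bsum_le (bsumZ (_ : 0 <= x / r) P_r) => // [w Pw|]; last by rewrite divr_ge0 // ltW.
  have [wp w0] := prime_pos Pw; have := sumn_gt0 wp w0; rewrite /pw.
  case: (sumn w) => // n _; have -> : x ^+ n.+1 = x / r * (r * x ^+ n).
    by rewrite mulrA mulfVK ?gt_eqF // exprS.
  apply: ler_wpM2l; first by rewrite divr_ge0 // ltW.
  rewrite exprS; apply: ler_wpM2l; first exact: ltW.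
  by apply: lerXn2r; rewrite ?nnegrE ltW.
have q1 : x / r * 1 < 1 by rewrite mulr1 ltr_pdivrMr // mul1r.
have [w|M bM] := bsum_hull (pw_mult x0) _ bx q1.
  by move=> _; apply: pw_le; rewrite ltW // (lt_trans xr).
exists M => n; apply: le_trans (bM (F n) (F_uniq n) _); last by move=> c /F_hull[].
rewrite big_seq (eq_bigr (fun=> x ^+ n)); last by move=> c /F_hull[_ <-].
by rewrite -big_seq big_const_seq count_predT iter_addr addr0 mulr_natl.
Qed.

(** Chernoff's bound: a word of sum n with [d * n <= Y c] has tilted weight at least b^n, where b =
    r expR (t d) > r, so there are at most M / b^n of them. [F n] has at least c / x^n words for an
    [x] between [r] and [b]. *)
Lemma tail_small (Y : seq nat -> R) (K t q d e : R) : additive_stat Y K -> 0 < t ->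
  r * expR (t * K) <= y -> q < 1 -> bsum P (tilt r t Y) q -> 0 < d -> 0 < e ->
  exists N, forall n, (N <= n)%N ->
    (count (fun c => d * n%:R <= Y c) (F n))%:R <= e * (size (F n))%:R.
Proof.
move=> Ya t0 tK q1 bq d0 e0.
have [w|M bM] := bsum_hull (tilt_mul t r0 Ya) _ bq q1.
  by move=> wp; apply: tilt_le Ya tK wp; rewrite // ltW.
have M0 := bsum_ge0 bM.
pose b := r * expR (t * d).
have rb : r < b by rewrite /b ltr_pMr // expR_gt1 mulr_gt0.
pose x := (r + Num.min 1 b) / 2.
have [rx xb x1] : [/\ r < x, x < b & x < 1].
  have := lt_trans ry y1.
  by rewrite /x; case: (leP 1 b) => ?; split; lra.
have [|c c0 [N hN]] := @F_lower x; first by rewrite rx.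
have x0 := lt_trans r0 rx; have b0 := lt_trans r0 rb.
have [||N' hN'] := @expr_small R (x / b) (e * c / (M + 1)).
- by rewrite (divr_ge0 (ltW x0) (ltW b0)) /= ltr_pdivrMr // mul1r.
- by rewrite divr_gt0 ?mulr_gt0 //; lra.
exists (maxn N N') => n; rewrite geq_max => /andP[/hN Nn /hN'].
rewrite ltr_pdivlMr; last by lra.
set h := (x / b) ^+ n => hM.
have h0 : 0 < h by rewrite exprn_gt0 // divr_gt0.
have xE : x ^+ n = h * b ^+ n by rewrite -exprMn mulfVK // gt_eqF.
have bn0 : 0 < b ^+ n by rewrite exprn_gt0.
set k := count _ _; set f := (size (F n))%:R in Nn *.
have kM : k%:R * b ^+ n <= M.
  pose l := [seq c <- F n | d * n%:R <= Y c].
  have <- : \sum_(c <- l) b ^+ n = k%:R * b ^+ n.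
    by rewrite big_const_seq count_predT size_filter iter_addr addr0 mulr_natl.
  apply: le_trans (bM l (filter_uniq _ (F_uniq n)) _); last first.
    by move=> u; rewrite mem_filter => /andP[_ /F_hull[]].
  rewrite big_seq [leRHS]big_seq; apply: ler_sum => u.
  rewrite mem_filter => /andP[du /F_hull[_ un]].
  rewrite /tilt /pw un /b exprMn; apply: ler_wpM2l; first by rewrite exprn_ge0 // ltW.
  by rewrite -expRM_natr ler_expR -mulrA ler_wpM2l // ltW.
have h1 : h * (M + 1) <= h * (e * f * b ^+ n).
  have -> : h * (e * f * b ^+ n) = e * (x ^+ n * f) by rewrite xE; ring.
  by apply: le_trans (ltW hM) _; rewrite ler_wpM2l // ltW.
rewrite -(ler_pM2r bn0); move: h1; rewrite ler_pM2l // => h1.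
by apply: le_trans kM _; lra.
Qed.

Section Mean.
Variable X : seq nat -> R.
Hypotheses (X_nil : X [::] = 0) (X_cat : forall u v, X (u ++ v) = X u + X v).
Hypothesis X_le : forall w, all (leq 1) w -> 0 <= X w <= (sumn w)%:R.
Hypothesis P_ex : exists w, P w.

Let sz (w : seq nat) : R := (sumn w)%:R.

Definition moment (Z : seq nat -> R) : R := ssum P (fun w => pw r w * Z w).

(** Passing from [r] to y = r (1 + h) gains a factor (1 + h)^n >= n h, which pays for the linear
    growth of [Z]. *)
Lemma bsum_moment Z : (forall w, all (leq 1) w -> 0 <= Z w <= sz w) ->
  bsum P (fun w => pw r w * Z w) (moment Z).
Proof.
move=> Zle; have [M bM] := P_y; pose h := y / r - 1.
have yr : 1 < y / r by rewrite ltr_pdivlMr // mul1r.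
have h0 : 0 < h by rewrite subr_gt0.
apply: (@bsum_ssum _ _ _ _ (h^-1 * M)).
have hge : 0 <= h^-1 by rewrite invr_ge0 ltW.
apply: bsum_le (bsumZ hge bM) => // w /prime_pos[/Zle /andP[Z0 Zs] _].
have -> : pw y w = pw r w * (1 + h) ^+ sumn w.
  by rewrite /pw -exprMn /h addrC subrK mulrC mulfVK // gt_eqF.
rewrite mulrCA; apply: ler_wpM2l; first by rewrite ltW // pw_gt0.
rewrite mulrC ler_pdivlMr //; apply: (@le_trans _ _ (sz w * h)).
  by rewrite ler_wpM2r // ltW.
rewrite /sz; elim: (sumn w) => [|n IHn]; first by rewrite mul0r expr0.
have e1 : 1 <= (1 + h) ^+ n by rewrite exprn_ege1 // lerDl ltW.
by rewrite exprS -natr1; nra.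
Qed.

Lemma sz_le w : all (leq 1) w -> 0 <= sz w <= sz w.
Proof. by rewrite lexx ler0n. Qed.

Lemma moment_ge0 : 0 <= moment X.
Proof. by have := bsum_ge0 (bsum_moment X_le). Qed.

Lemma moment_sz_gt0 : 0 < moment sz.
Proof.
have [w Pw] := P_ex; have [wp w0] := prime_pos Pw.
have := @bsum_moment _ sz_le [:: w] isT; rewrite big_seq1 => h.
apply: lt_le_trans (h _); last by move=> t; rewrite inE => /eqP->.
by rewrite mulr_gt0 ?pw_gt0 // ltr0n sumn_gt0.
Qed.

Lemma moment_approx Z e : (forall w, all (leq 1) w -> 0 <= Z w <= sz w) -> 0 < e ->
  exists l0, [/\ uniq l0, forall t, t \in l0 -> P t & forall l, uniq l ->
    (forall t, t \in l -> P t) -> {subset l0 <= l} ->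
    moment Z - e <= \sum_(w <- l) pw r w * Z w <= moment Z].
Proof.
move=> Zle e0; have bM := bsum_moment Zle.
have [l0 [ul0 l0P h]] := ssum_adherent bM e0; exists l0; split=> // l ul lP l0l.
rewrite bM // andbT; apply: le_trans (ltW h) _.
apply: sum_sub_le => // t /lP Pt; apply: mulr_ge0; first by rewrite ltW // pw_gt0.
by have [/Zle /andP[]] := prime_pos Pt.
Qed.

Definition mean : R := moment X / moment sz.

Let mean_ge0 : 0 <= mean.
Proof. by rewrite divr_ge0 ?moment_ge0 // ltW // moment_sz_gt0. Qed.

Lemma deviation_tilts a : 0 < a -> exists l0 e,
  [/\ 0 < e, uniq l0, forall t, t \in l0 -> P t & forall l, uniq l ->
    (forall t, t \in l -> P t) -> {subset l0 <= l} ->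
    \sum_(w <- l) pw r w * (X w - (mean + a) * sz w) <= - e /\
    \sum_(w <- l) pw r w * ((mean - a) * sz w - X w) <= - e].
Proof.
move=> a0; have v0 := mean_ge0; have mu0 := moment_sz_gt0.
have vE : moment X = mean * moment sz by rewrite mulfVK // gt_eqF.
(* Replacing moments by finite sums with error [z] costs at most (mean + a + 1) z, half of the drift
   [a * moment sz]. *)
pose z := a * moment sz / (2 * (mean + a + 1)).
have D0 : 0 < 2 * (mean + a + 1) by lra.
have z0 : 0 < z by rewrite divr_gt0 // mulr_gt0.
have zE : z * (2 * (mean + a + 1)) = a * moment sz by rewrite mulfVK // gt_eqF.
have [l1 [ul1 l1P h1]] := moment_approx X_le z0.
have [l2 [ul2 l2P h2]] := moment_approx sz_le z0.
have lE t : t \in undup (l1 ++ l2) = (t \in l1) || (t \in l2).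
  by rewrite mem_undup mem_cat.
exists (undup (l1 ++ l2)), (a * moment sz / 2); split.
- by rewrite divr_gt0 // mulr_gt0.
- exact: undup_uniq.
- by move=> t; rewrite lE => /orP[/l1P|/l2P].
move=> l ul lP l0l.
have /andP[x1 x2] : moment X - z <= \sum_(w <- l) pw r w * X w <= moment X.
  by apply: h1 => // t tl; apply: l0l; rewrite lE tl.
have /andP[s1 s2] : moment sz - z <= \sum_(w <- l) pw r w * sz w <= moment sz.
  by apply: h2 => // t tl; apply: l0l; rewrite lE tl orbT.
have lin b c : \sum_(w <- l) pw r w * (b * X w + c * sz w) =
    b * (\sum_(w <- l) pw r w * X w) + c * (\sum_(w <- l) pw r w * sz w).
  rewrite !big_distrr -big_split; apply: eq_bigr => w _ /=; ring.
split.
  under eq_bigr do rewrite -[X _]mul1r -mulNr.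
  by rewrite lin; nra.
under eq_bigr do rewrite -[X _]mul1r addrC -mulNr.
by rewrite lin; nra.
Qed.

Lemma mean_limit e : 0 < e -> exists N, forall n, (N <= n)%N ->
  `|\sum_(c <- F n) X c - mean * n%:R * (size (F n))%:R| <= e * n%:R * (size (F n))%:R.
Proof.
move=> e0; have v0 := mean_ge0; pose a := e / 4.
have a0 : 0 < a by rewrite divr_gt0.
pose K := mean + a + 1; have K0 : 0 < K by rewrite /K; lra.
have [l0 [d [d0 ul0 l0P hl]]] := deviation_tilts a0.
have [M bM] := P_y; have r0y : 0 < r < y by rewrite r0.
have P_pos w : P w -> all (leq 1) w by case/prime_pos.
have szD u v : sz (u ++ v) = sz u + sz v by rewrite /sz sumn_cat natrD.
have sz0 : sz [::] = 0 by [].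
have Y1 : additive_stat (fun w => X w - (mean + a) * sz w) K.
  split; first by rewrite X_nil sz0 mulr0 subr0.
    by move=> u v; rewrite X_cat szD; ring.
  move=> u /X_le; rewrite -/(sz u) => /andP[h1 h2].
  by rewrite ler_norml /K; apply/andP; split; nra.
have Y2 : additive_stat (fun w => (mean - a) * sz w - X w) K.
  split; first by rewrite X_nil sz0 mulr0 subr0.
    by move=> u v; rewrite X_cat szD; ring.
  move=> u /X_le; rewrite -/(sz u) => /andP[h1 h2].
  by rewrite ler_norml /K; apply/andP; split; nra.
have [t1 [q1 [t10 tK1 q11 bq1]]] := bsum_tilt r0y K0 Y1 P_pos P_r bM d0 ul0 l0P
  (fun l ul lP l0l => proj1 (hl l ul lP l0l)).
have [t2 [q2 [t20 tK2 q21 bq2]]] := bsum_tilt r0y K0 Y2 P_pos P_r bM d0 ul0 l0P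
  (fun l ul lP l0l => proj2 (hl l ul lP l0l)).
(* Off the two rare sets the deviation is at most 2 a n = e n / 2. On each of them it is at most (1
   + mean) n, so a share [b] of the words contributes at most e n / 4 on average. *)
pose b := e / (4 * (1 + mean)).
have b0 : 0 < b by rewrite divr_gt0 //; lra.
have bE : b * (4 * (1 + mean)) = e by rewrite mulfVK // gt_eqF //; lra.
have [N1 hN1] := tail_small Y1 t10 tK1 q11 bq1 a0 b0.
have [N2 hN2] := tail_small Y2 t20 tK2 q21 bq2 a0 b0.
exists (maxn N1 N2) => n; rewrite geq_max => /andP[/hN1 {}hN1 /hN2 {}hN2].
set f := (size (F n))%:R in hN1 hN2 *.
have countE (Q : pred (seq nat)) : (count Q (F n))%:R = \sum_(c <- F n) (Q c)%:R :> R.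
  by elim: (F n) => [|c l IHl] /=; rewrite ?big_nil // big_cons natrD IHl.
have constE (z : R) : \sum_(c <- F n) z = z * f.
  by rewrite big_const_seq count_predT iter_addr addr0 mulr_natr.
set Q1 := (fun c => _) in hN1; set Q2 := (fun c => _) in hN2.
have n0 : 0 <= n%:R :> R by [].
have f0 : 0 <= f by rewrite ler0n.
rewrite -constE -sumrB; apply: le_trans (ler_norm_sum _ _ _) _.
apply: (@le_trans _ _ (\sum_(c <- F n) (2 * a * n%:R +
    ((1 + mean) * n%:R * (Q1 c)%:R + (1 + mean) * n%:R * (Q2 c)%:R)))).
  rewrite big_seq [leRHS]big_seq; apply: ler_sum => c /F_hull[/hull_pos/X_le + cn].
  rewrite cn => /andP[Xc0 Xcn]; rewrite /Q1 /Q2 /sz cn.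
  have h1 := mulr_ge0 v0 n0; have h2 := mulr_ge0 (ltW a0) n0.
  have [g1|g1] := leP (a * n%:R) (X c - (mean + a) * n%:R);
  have [g2|g2] := leP (a * n%:R) ((mean - a) * n%:R - X c);
  by rewrite ler_norml /=; apply/andP; split; lra.
rewrite !big_split /= -!big_distrr /= -!countE constE.
have h1 : (1 + mean) * n%:R * (count Q1 (F n))%:R <= (1 + mean) * n%:R * (b * f).
  by apply: ler_wpM2l => //; apply: mulr_ge0 => //; lra.
have h2 : (1 + mean) * n%:R * (count Q2 (F n))%:R <= (1 + mean) * n%:R * (b * f).
  by apply: ler_wpM2l => //; apply: mulr_ge0 => //; lra.
have h3 : (1 + mean) * n%:R * (b * f) = e / 4 * n%:R * f by rewrite -bE; field.
by rewrite /a; lra.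
Qed.

Lemma average_limit e : 0 < e -> exists N, forall n, (N <= n)%N ->
  `|(\sum_(c <- F n) X c) / (size (F n))%:R / n%:R - mean| <= e.
Proof.
move=> e0; have [N hN] := mean_limit e0.
have [|c c0 [N' hN']] := @F_lower ((r + 1) / 2).
  by have := lt_trans ry y1; move=> r1; apply/andP; split; lra.
exists (maxn N (maxn N' 1)) => n; rewrite !geq_max => /and3P[/hN h /hN' h' n1].
have n0 : 0 < n%:R :> R by rewrite ltr0n.
have f0 : 0 < (size (F n))%:R :> R.
  rewrite lt0r ler0n andbT; apply/eqP => f0; move: h'; rewrite f0 mulr0.
  by rewrite leNgt c0.
set T := \sum_(c <- F n) X c in h *; set f := (size (F n))%:R in h f0 *.
have nf : 0 < n%:R * f by rewrite mulr_gt0.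
have -> : T / f / n%:R - mean = (T - mean * n%:R * f) / (n%:R * f).
  by field; rewrite !gt_eqF.
by rewrite normrM (@gtr0_norm _ (n%:R * f)^-1) ?invr_gt0 // ler_pdivrMr // mulrA.
Qed.

End Mean.
End Hull.

(** * Large parts *)

Section Hole.
Variables (R : realType) (m p : nat).
Hypothesis p0 : (0 < p)%N.
Variable I : nat -> seq nat -> Prop.
Hypothesis Il : local_family m p I.
Hypothesis Ifree : forall j l r, size l = p -> size r = p ->
  (forall N, exists2 x, (N <= x)%N & I j (l ++ x :: r)) ->
  exists M, forall x, (M <= x)%N -> I j (l ++ x :: r).
Variable s : nat * seq nat.
Hypothesis sp : size s.2 = p.
Variables (r y : R).
Hypotheses (r0 : 0 < r) (ry : r < y) (y1 : y < 1).

Local Notation P := (prime_loop m I s).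
Local Notation occ := (occ m).

Hypothesis avoiding_y : exists M, bsum (somewhere (avoiding m I s)) (pw y) M.

(* A prime loop in which the part [k] has been removed at a marked place. For large
   [k] membership no longer depends on [k], by asymptotic freeness. *)
Definition hole k (t : seq nat * seq nat) : Prop := P (t.1 ++ k :: t.2).

Definition eventual_hole t : Prop := exists N, forall k, (N <= k)%N -> hole k t.

Definition pair_weight (t : seq nat * seq nat) : R := pw r t.1 * pw r t.2.

(** An occurrence of the block cannot cover a part that the block does not contain. *)
Lemma occ_hole i a k k' b l : k \notin s.2 -> k' \notin s.2 ->
  occ s i (a ++ k :: b) l -> occ s i (a ++ k' :: b) l.
Proof.
move=> ks ks' ol; have [h|h] := leqP (l + p) (size a).
  by move: ol; rewrite !occ_catr ?sp.
have [la|al] := leqP l (size a).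
  have := occ_nth (n := size a) p0 sp ol; rewrite la h nth_cat ltnn subnn /= => /(_ isT).
  by rewrite (negbTE ks).
rewrite -cat_rcons; move: ol; rewrite -cat_rcons.
have [l' ->] : exists l', l = ((size a).+1 + l')%N by exists (l - (size a).+1)%N; lia.
by rewrite -{1}(size_rcons a k) -{1}(size_rcons a k') !occ_catl !size_rcons.
Qed.

Lemma hole_replace k k' t : k \notin s.2 -> k' \notin s.2 -> hole k t ->
  I s.1 (s.2 ++ t.1 ++ k' :: t.2) -> hole k' t.
Proof.
case: t => u v /= ks ks' [[Iw ow] w0 av] Iw'; have eqs : size (u ++ k' :: v) = size (u ++ k :: v).
  by rewrite !size_cat.
split; rewrite /= ?eqs.
- by split; rewrite // eqs; move: ow; rewrite !catA; exact: occ_hole.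
- by rewrite -size_eq0 size_cat /= addnS.
- move=> l hl; apply/negP => ol; move/negP: (av l hl); apply.
  by move: ol; rewrite !catA; exact: occ_hole.
Qed.

(** The loop ends with the block of [s], which does not contain [k], so that block lies entirely
    after the hole. *)
Lemma hole_size k t : k \notin s.2 -> hole k t -> (p <= size t.2)%N.
Proof.
case: t => u v /= ks [[Iw ow] _ _]; rewrite leqNgt; apply/negP => vp.
have := occ_nth (n := size (s.2 ++ u)) p0 sp ow.
rewrite catA nth_cat ltnn subnn /= !size_cat sp /= (negbTE ks).
have -> : (size u + (size v).+1 <= p + size u < size u + (size v).+1 + p)%N by lia.
by move=> /(_ isT).
Qed.

Lemma big_notin k : (\max_(a <- s.2) a < k)%N -> k \notin s.2.
Proof.
move=> sk; apply/negP => ks; have : (k <= \max_(a <- s.2) a)%N by exact: leq_bigmax_seq.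
by rewrite leqNgt sk.
Qed.

(** If arbitrarily large parts fill the hole, freeness applies to the [p] parts on either side of
    it: the left ones end [s.2 ++ u], the right ones exist by [hole_size]. The new middle is then
    glued back along these two blocks. *)
Lemma hole_dichotomy t : exists N, (forall k, (N <= k)%N -> hole k t) \/
  (forall k, (N <= k)%N -> ~ hole k t).
Proof.
have [/asboolP[N hN]|/asboolPn H] := boolP `[< exists N, forall k, (N <= k)%N -> ~ hole k t >].
  by exists N; right.
have {}H N : exists2 k, (N <= k)%N & hole k t.
  by apply: contrapT => H'; apply: H; exists N => k Nk hk; apply: H'; exists k.
case: t H => u v H; pose B := (\max_(a <- s.2) a).+1.
have [k0 /big_notin k0s hk0] := H B; have vp := hole_size k0s hk0.
pose i := (s.1 + size u)%N.
pose l := drop (size u) (s.2 ++ u); pose a := take (size u) (s.2 ++ u).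
have al : s.2 ++ u = a ++ l by rewrite cat_take_drop.
have sa : size a = size u by rewrite size_takel // size_cat leq_addl.
have lp : size l = p by rewrite size_drop size_cat sp addnK.
have vE := cat_take_drop p v; have bp : size (take p v) = p by rewrite size_takel.
have wE k : s.2 ++ u ++ k :: v = a ++ (l ++ k :: take p v) ++ drop p v.
  by rewrite catA al -!catA /= vE.
have [|M hM] := @Ifree i l (take p v) lp bp.
  move=> N; have [k Nk [[Iw _] _ _]] := H N; exists k => //.
  by move: Iw; rewrite /= wE => Iw; apply: (local_sub Il Iw); rewrite sa.
exists (maxn M B); left => k; rewrite geq_max => /andP[/hM Ik /big_notin ks].
apply: (hole_replace k0s ks hk0) => /=; rewrite wE.
have [[/= Iw0 _] _ _] := hk0; rewrite wE in Iw0.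
have I1 : I s.1 (a ++ l ++ k :: take p v).
  apply: (local_splice Il _ _ _ Ik); rewrite ?lp ?sa //.
  by have [[/= Iw _] _ _] := hk0; move: Iw; rewrite catA al; exact: (local_left Il).
have E b : a ++ (l ++ k :: take p v) ++ b = (a ++ l ++ [:: k]) ++ take p v ++ b.
  by rewrite -!catA.
rewrite E; apply: (local_splice (j := (i + p.+1)%N) Il); rewrite ?bp //.
- by have := E [::]; rewrite !cats0 => <-.
- by rewrite !size_cat sa lp addn1 /i addnA.
have E0 : a ++ (l ++ k0 :: take p v) ++ drop p v = (a ++ l ++ [:: k0]) ++ take p v ++ drop p v.
  by rewrite -!catA.
rewrite E0 in Iw0; apply: (local_right Il Iw0).
by rewrite !size_cat sa lp addn1 /i addnA.
Qed.

Definition hole_domain t : Prop := exists2 k, k \notin s.2 & hole k t.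

Lemma eventual_in_domain t : eventual_hole t -> hole_domain t.
Proof.
move=> [N hN]; exists (maxn N (\max_(a <- s.2) a).+1); last by apply: hN; exact: leq_maxl.
by apply: big_notin; exact: leq_maxr.
Qed.

Lemma pair_weight_gt0 t : 0 < pair_weight t.
Proof. by rewrite mulr_gt0 // pw_gt0. Qed.

(** The part before the hole leaves [s] without returning, and the part after it, short of its last
    letter, avoids [s]; both families converge at [y]. This is the dominating sum for the limit over
    [k]. *)
Lemma bsum_hole_domain : exists M, bsum hole_domain pair_weight M.
Proof.
have [M bM] := avoiding_y; have y0 : 0 < y by exact: lt_trans ry.
have yl : 0 <= y < 1 by rewrite ltW.
have wy w : pw r w <= pw y w by apply: pw_le; exact: ltW.
have b1 := bsum_avoiding_tail p0 (pw_mult y0) Il sp bM.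
have b2 := bsum_cat (pw_mult y0) bM (bsum_letter (K := 0) yl).
have r_ge w : 0 <= pw y w by rewrite ltW // pw_gt0.
exists (M / pw y (behead s.2) * (M * (y ^+ 0 / (1 - y)))).
apply: bsum_le (bsum_pair r_ge r_ge b1 b2) => // -[u v]; last first.
  by move=> _; apply: ler_pM => //; rewrite ltW // pw_gt0.
move=> [k ks /[dup] hk /= [[Iw ow] _ av]]; have vp := hole_size ks hk; split=> /=.
  split; first by move: Iw; rewrite catA; exact: (local_left Il).
  move=> l l0; apply/negP => ol; have := occ_bound p0 sp ol.
  rewrite size_cat sp addnC leq_add2l => lu; have := av l.
  rewrite (@occ_walkl _ p) // ol l0 size_cat /= => /(_ _)/negP; apply=> //; lia.
case/lastP: v vp hk Iw ow av => [|v c] vp hk Iw ow av; first by move: p0; rewrite lt0n -leqn0 vp.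
exists v, [:: c]; rewrite cats1; split=> //; last by exists c.
have E : s.2 ++ u ++ k :: rcons v c = (s.2 ++ rcons u k) ++ v ++ [:: c].
  by rewrite -cats1 -!catA cat_rcons.
exists (s.1 + size (s.2 ++ rcons u k))%N; split.
  by rewrite E in Iw; exact: (local_sub Il Iw).
move=> l; apply/negP => ol; have lv := occ_bound p0 sp ol.
have := av (size (rcons u k) + p + l)%N.
have -> : (size (rcons u k) + p + l)%N = (size (s.2 ++ rcons u k) + l)%N.
  by rewrite size_cat sp [(p + _)%N]addnC.
rewrite E occ_catl occ_catr ?sp // ol !size_cat /= !size_rcons sp => /(_ _)/negP; apply=> //.
move: (size u) (size v) lv => a b lv; lia.
Qed.

Lemma hole_limit e : 0 < e -> exists N, forall k, (N <= k)%N ->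
  `|ssum (hole k) pair_weight - ssum eventual_hole pair_weight| <= e.
Proof.
move=> e0; have [M bM] := bsum_hole_domain.
have g0 t : 0 <= pair_weight t by rewrite ltW // pair_weight_gt0.
have [L [uL LD LE]] := ssum_adherent bM e0.
have [N0 hN0] : exists N0, forall k, (N0 <= k)%N ->
    forall t, t \in L -> (hole k t <-> eventual_hole t).
  elim: L {uL LD LE} => [|t L [N1 IHL]]; first by exists 0.
  have [N2 hN2] := hole_dichotomy t; exists (maxn N1 N2) => k.
  rewrite geq_max => /andP[/IHL h1 k2] t'; rewrite inE => /orP[/eqP->|/h1//].
  split; case: hN2 => hN2 H; [by exists N2| by case: (hN2 k)| exact: hN2|].
  by case: H => N H; case: (hN2 (maxn N N2)); rewrite ?leq_maxr //; apply: H; rewrite leq_maxl.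
exists (maxn N0 (\max_(a <- s.2) a).+1) => k; rewrite geq_max => /andP[/hN0 h /big_notin ks].
have kD t : hole k t -> hole_domain t by exists k.
have h1 := ssum_perturb g0 bM uL LD (ltW LE) kD eventual_in_domain (fun t tL => proj1 (h t tL)).
have h2 := ssum_perturb g0 bM uL LD (ltW LE) eventual_in_domain kD (fun t tL => proj2 (h t tL)).
by rewrite ler_norml; apply/andP; split; lra.
Qed.

Lemma eventual_hole_gt0 : (exists t, eventual_hole t) -> 0 < ssum eventual_hole pair_weight.
Proof.
move=> [t ht]; have [M bM] := bsum_hole_domain.
have := bsum_ssum (bsum_sub eventual_in_domain bM) (l := [:: t]).
rewrite big_seq1 => /(_ isT) h; apply: lt_le_trans (h _); first exact: pair_weight_gt0.
by move=> t'; rewrite inE => /eqP->.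
Qed.

Definition occurrences k (w : seq nat) : seq nat :=
  [seq i <- iota 0 (size w) | nth 0%N w i == k].

Lemma size_occurrences k w : size (occurrences k w) = count_mem k w.
Proof.
rewrite size_filter -{3}(mkseq_nth 0%N w) /mkseq count_map.
by apply: eq_count => i.
Qed.

Definition holes k w := [seq (take i w, drop i.+1 w) | i <- occurrences k w].

Lemma holesP k w t : reflect (w = t.1 ++ k :: t.2) (t \in holes k w).
Proof.
apply: (iffP mapP) => [[i]|->].
  rewrite mem_filter mem_iota add0n => /and3P[/eqP ik _ iw] -> /=.
  by rewrite -ik -drop_nth // cat_take_drop.
exists (size t.1).
  by rewrite mem_filter mem_iota nth_cat ltnn subnn eqxx /= add0n size_cat /= addnS leq_addr.
by rewrite take_size_cat // -cat_rcons drop_size_cat ?size_rcons //; case: (t).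
Qed.

(** Double counting of prime loops with a marked part [k]: removing that part takes out the factor
    r^k. *)
Lemma moment_count k : k \notin s.2 ->
  bsum P (fun w => pw r w * (count_mem k w)%:R) (moment m I s r (fun w => (count_mem k w)%:R)) ->
  moment m I s r (fun w => (count_mem k w)%:R) = r ^+ k * ssum (hole k) pair_weight.
Proof.
move=> ks bP; have [M bM] := bsum_hole_domain.
have bH : bsum (hole k) pair_weight (ssum (hole k) pair_weight).
  by apply: (@bsum_ssum _ _ _ _ M); apply: bsum_sub bM => t ht; exists k.
pose hl (l : seq (seq nat)) := [seq t | w <- l, t <- holes k w].
have hlE l : r ^+ k * (\sum_(t <- hl l) pair_weight t) =
    \sum_(w <- l) pw r w * (count_mem k w)%:R.
  rewrite big_allpairs_dep big_distrr /=; apply: eq_bigr => w _.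
  rewrite big_distrr /= (eq_big_seq (fun=> pw r w)) => [|t /holesP wE]; last first.
    by rewrite wE /pw sumn_cat /= !exprD; rewrite /pair_weight /pw; ring.
  by rewrite big_const_seq count_predT size_map size_occurrences iter_addr addr0 mulr_natr.
have hl_uniq l : uniq l -> uniq (hl l).
  move=> ul; apply: allpairs_uniq_dep => // [w _|].
    rewrite map_inj_in_uniq ?filter_uniq ?iota_uniq // => i i'.
    rewrite !mem_filter !mem_iota /= !add0n => /andP[_ iw] /andP[_ iw'] [e _].
    by have := congr1 size e; rewrite !size_takel // ltnW.
  move=> _ _ /allpairsPdep[w [t [wl /holesP wE ->]]]
    /allpairsPdep[w' [t' [wl' /holesP wE' ->]]] /= tt'.
  by rewrite wE wE' tt'.
apply/eqP; rewrite eq_le; apply/andP; split.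
  apply: ssum_le => l ul lP; rewrite -hlE; apply: ler_wpM2l; first by rewrite exprn_ge0 // ltW.
  apply: bH; first exact: hl_uniq.
  by move=> _ /allpairsPdep[w [t [/lP Pw /holesP wE ->]]]; rewrite /hole -wE.
rewrite mulrC -ler_pdivlMr ?exprn_gt0 //; apply: ssum_le => L uL LH.
rewrite ler_pdivlMr ?exprn_gt0 // mulrC.
pose l := undup [seq t.1 ++ k :: t.2 | t <- L].
have lP w : w \in l -> P w by rewrite mem_undup => /mapP[t /LH ? ->].
apply: le_trans (bP l (undup_uniq _) lP); rewrite -hlE.
apply: ler_wpM2l; first by rewrite exprn_ge0 // ltW.
apply: sum_sub_le => // [t _|t tL]; first by rewrite ltW // pair_weight_gt0.
apply/allpairsPdep; exists (t.1 ++ k :: t.2), t; split=> //; last exact/holesP.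
by rewrite mem_undup; apply/mapP; exists t.
Qed.

End Hole.

(** * Interior words of a class *)

Section LocalRestriction.
Local Open Scope nat_scope.
Variables m p : nat.
Implicit Types (phi : lrf m p) (a b s t u v x y z c : seq nat).

Lemma part_catl u v v' (i : int) : (i <= (size u)%:Z)%R -> part (u ++ v) i = part (u ++ v') i.
Proof.
case: i => [[|i]|i] //= iu; rewrite !nth_cat ltnNge.
by have -> : size u <= i = false by lia.
Qed.

Lemma part_catr u v (i : int) : ((size u)%:Z < i)%R ->
  part (u ++ v) i = part v (i - (size u)%:Z)%R.
Proof.
case: i => [[|i]|i] ui; [by exfalso; lia | | by exfalso; lia].
have ui' : size u <= i by lia.
have -> : (Posz i.+1 - (size u)%:Z)%R = Posz (i - size u).+1 by lia.
by rewrite /= nth_cat ltnNge ui'.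
Qed.

(** A window has p + 1 parts: up to the end of [b] it sees only [a ++ b], and beyond that it reaches
    back no further than into [b]. So each window already occurs in one of the two given
    compositions, at the same residue. *)
Lemma comp_class_splice phi a a' b z z' : p <= size b ->
  size a = size a' %[mod m] ->
  comp_class phi (a ++ b ++ z) -> comp_class phi (a' ++ b ++ z') ->
  comp_class phi (a ++ b ++ z').
Proof.
move=> pb aa' [c1 h1] [c2 h2]; split.
  by move: c1 c2; rewrite /composition !all_cat => /and3P[-> -> _] /and3P[_ _ ->].
move=> i h ih; have [le_i|lt_i] := lerP i (size (a ++ b))%:Z.
  have -> : window p (a ++ b ++ z') i = window p (a ++ b ++ z) i.
    apply: eq_mktuple => l; rewrite !catA; apply: part_catl; lia.
  exact: h1.
rewrite size_cat in lt_i.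
have -> : window p (a ++ b ++ z') i =
    window p (a' ++ b ++ z') (i - (size a)%:Z + (size a')%:Z)%R.
  apply: eq_mktuple => l; have := ltn_ord l; rewrite ltnS => lp.
  rewrite part_catr; last by lia.
  rewrite [RHS]part_catr; last by lia.
  by congr part; lia.
apply: h2; rewrite -ih {1}(divn_eq (size a) m) {1}(divn_eq (size a') m) aa'.
have -> : (i - (size a %/ m * m + size a' %% m)%N%:Z + (size a' %/ m * m + size a' %% m)%N%:Z =
  ((size a' %/ m)%:Z - (size a %/ m)%:Z) * m%:Z + i)%R by rewrite !PoszD !PoszM; ring.
by rewrite modzMDl.
Qed.

(** Copies not lying inside [y] start within [a] or at one of |s| + |z| late offsets, collected in
    [T]; one copy more must lie inside [y]. *)
Lemma copies_mid j s a y z : size a + size s + size z < copies m j s (a ++ y ++ z) ->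
  exists y1 y2, y = y1 ++ s ++ y2 /\ (size a + size y1).+1 = j %[mod m].
Proof.
set Q := fun l => prefix s (drop l (a ++ y ++ z)) && (l.+1 == j %[mod m]).
move=> many.
have [l [Ql al ly]] : exists l, [/\ Q l, size a <= l & l + size s <= size a + size y].
  apply: contrapT => H; move: many; rewrite /copies -/Q -size_filter ltnNge => /negP; apply.
  pose T := iota 0 (size a) ++ iota ((size a + size y).+1 - size s) (size s + size z).
  have -> : size a + size s + size z = size T by rewrite size_cat !size_iota addnA.
  apply: uniq_leq_size; first by rewrite filter_uniq // iota_uniq.
  move=> l; rewrite mem_filter mem_iota mem_cat !mem_iota !add0n !size_cat => /andP[Ql lN].
  have [//|al] := ltnP l (size a); have [ly|ly] := leqP (l + size s) (size a + size y).
    by case: H; exists l.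
  by move: (size a) (size s) (size y) (size z) lN al ly => A S Y Z; lia.
have /andP[/prefixP[v]] := Ql; rewrite drop_cat ltnNge al /=.
have [k lk] : exists k, l = size a + k by exists (l - size a); rewrite subnKC.
rewrite lk addKn in ly *; rewrite -addnA leq_add2l in ly.
have ky : k <= size y by apply: leq_trans ly; exact: leq_addr.
rewrite drop_cat.
have dE : (if k < size y then drop k y ++ z else drop (k - size y) z) = drop k y ++ z.
  case: ltnP => // yk; have -> : k = size y by apply/eqP; rewrite eqn_leq ky.
  by rewrite subnn drop0 drop_size.
rewrite dE => E /eqP jl; exists (take k y), (drop (size s) (drop k y)); split.
  rewrite -{1}(cat_take_drop k y) -{1}(cat_take_drop (size s) (drop k y)); congr (_ ++ (_ ++ _)).
  have sky : size s <= size (drop k y) by rewrite size_drop leq_subRL // addnC.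
  by have := congr1 (take (size s)) E; rewrite takel_cat // (take_size_cat _ (erefl (size s))).
by rewrite size_takel.
Qed.

Lemma recurrent_at_mod phi i j s : i = j %[mod m] ->
  recurrent_at phi i s -> recurrent_at phi j s.
Proof.
move=> ij [s0 sc rs]; split=> // k a x z axz ap zp.
have [y ayz ky] := rs k a x z axz ap zp; exists y => //.
by move: ky; rewrite /copies; congr (_ <= _); apply: eq_count => l; rewrite ij.
Qed.

Lemma recurrent_at_sub phi j u s v : s != [::] -> recurrent_at phi j (u ++ s ++ v) ->
  recurrent_at phi (j + size u) s.
Proof.
move=> s0 [_ [c Cc infx] rs]; split=> //.
  exists c => //; case/infixP: infx => c1 [c2 ->].
  by apply/infixP; exists (c1 ++ u), (v ++ c2); rewrite !catA.
move=> k a x z axz ap zp; have [y ayz ky] := rs k a x z axz ap zp; exists y => //.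
apply: leq_trans ky _; rewrite /copies -!size_filter -[leqLHS](size_map (addn (size u))).
apply: uniq_leq_size.
  by rewrite map_inj_uniq ?filter_uniq ?iota_uniq //; exact: addnI.
move=> l1 /mapP[l]; rewrite mem_filter => /andP[/andP[/prefixP[w wE] /eqP lj] _] ->.
have dE : drop (size u + l) (a ++ y ++ z) = s ++ v ++ w.
  by rewrite -drop_drop wE -!catA drop_size_cat.
rewrite mem_filter mem_iota dE prefix_prefix add0n /=; apply/andP; split.
  by rewrite -addnS addnC -modnDml lj modnDml.
rewrite ltnNge; apply/negP => h; move: dE; rewrite drop_oversize // => /esym/eqP.
by move: s0; rewrite -!size_eq0 size_cat; case: (size s).
Qed.

Lemma recurrent_occurs phi j s a x z : recurrent_at phi j s ->
  comp_class phi (a ++ x ++ z) -> p <= size a -> p <= size z ->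
  exists y1 y2, comp_class phi (a ++ y1 ++ s ++ y2 ++ z) /\ (size a + size y1).+1 = j %[mod m].
Proof.
move=> [_ _ rs] axz ap zp.
have [y ayz /copies_mid[y1 [y2 [yE jE]]]] := rs (size a + size s + size z).+1 a x z axz ap zp.
by exists y1, y2; rewrite yE -!catA in ayz.
Qed.

(** The index is the number of parts before [s], whereas [recurrent_at] numbers positions from 1;
    hence the successors below. *)
Definition interior phi i s : Prop := exists a z,
  [/\ p <= size a, p <= size z, comp_class phi (a ++ s ++ z) & size a = i %[mod m]].

Lemma interior_mod phi i j s : i = j %[mod m] -> interior phi i s -> interior phi j s.
Proof. by move=> ij [a [z [ap zp C ai]]]; exists a, z; split=> //; rewrite ai. Qed.

Lemma interior_local phi : local_family m p (interior phi).
Proof.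
split.
- exact: interior_mod.
- move=> i u s v [a [z [ap zp C ai]]]; exists (a ++ u), (v ++ z); split.
  + by rewrite size_cat (leq_trans ap) // leq_addr.
  + by rewrite size_cat (leq_trans zp) // leq_addl.
  + by move: C; rewrite -!catA.
  + by rewrite size_cat -modnDml ai modnDml.
- move=> i u b v pb [a [z [ap zp C ai]]] [a' [z' [ap' zp' C' ai']]].
  exists a, z'; split=> //.
  have := @comp_class_splice phi (a ++ u) a' b z (v ++ z') pb.
  rewrite -!catA in C C' *; apply=> //.
  by rewrite size_cat -modnDml ai modnDml ai'.
- by move=> i s [a [z [_ _ [+ _] _]]]; rewrite /composition !all_cat => /and3P[].
Qed.

Lemma interior_of_recurrent phi j s : recurrent_at phi j.+1 s ->
  (exists c, comp_class phi c /\ p + p <= size c) -> interior phi j s.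
Proof.
move=> rs [c [Cc pc]]; rewrite -(cat_take_drop p c) -[drop p c]cat0s in Cc.
have s1 : size (take p c) = p by rewrite size_takel //; lia.
have [||y1 [y2 [C jE]]] := recurrent_occurs rs Cc.
- by rewrite s1.
- by rewrite size_drop; lia.
exists (take p c ++ y1), (y2 ++ drop p c); split.
- by rewrite size_cat s1 leq_addr.
- by rewrite size_cat size_drop; lia.
- by rewrite -!catA.
- by apply/eqP; rewrite -(eqn_modDr 1) !addn1 size_cat; apply/eqP.
Qed.

Hypothesis m0 : 0 < m.

Section Returns.
Variable phi : lrf m p.
Hypothesis phi_rec : recurrent phi.

Let shifts i t : {set 'I_m} := [set k : 'I_m | `[< recurrent_at phi (i + k).+1 t >]].

Let ord_of n : 'I_m := Ordinal (ltn_pmod n m0).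

Let modnDS i k k' : k = k' %[mod m] -> (i + k).+1 = (i + k').+1 %[mod m].
Proof. by move=> h; rewrite -!addSn -modnDmr h modnDmr. Qed.

Let shiftsP i t n : ord_of n \in shifts i t <-> recurrent_at phi (i + n).+1 t.
Proof.
rewrite inE; split=> [/asboolP|h]; last apply/asboolP.
  by apply: recurrent_at_mod; apply: modnDS; rewrite /= modn_mod.
by apply: recurrent_at_mod h; apply: modnDS; rewrite /= modn_mod.
Qed.

(* The shifts [k] such that [s], occurring at [i], recurs at [i + k] can only
   decrease when [s] is extended. If no extension loses a shift, they are closed
   under addition, hence contain 0. *)
Lemma interior_recurrent i s : interior phi i s -> s != [::] -> recurrent_at phi i.+1 s.
Proof.
have [n] := ubnP #|shifts i s|; elim: n i s => // n IHn i s sn [a [z [ap zp C ai]]] s0.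
pose K k := recurrent_at phi (i + k).+1 s.
have extend k : K k -> exists y, interior phi i (s ++ y ++ s) /\ size (s ++ y) = k %[mod m].
  move=> Kk; have [|||y1 [y2 [C' jE]]] := @recurrent_occurs phi (i + k).+1 s (a ++ s) [::] z Kk.
  - by rewrite -catA.
  - by rewrite size_cat (leq_trans ap) // leq_addr.
  - by [].
  exists y1; split.
    exists a, (y2 ++ z); split=> //; first by rewrite size_cat (leq_trans zp) // leq_addl.
    by rewrite -!catA in C' *.
  apply/eqP; rewrite -(eqn_modDl i.+1) !addSn -jE (size_cat a s) -addnA -size_cat.
  by rewrite [i + _]addnC [size a + _]addnC; apply/eqP/modnDS.
have [k0 Kk0] : exists k, K k.
  (* The multiple of [m] keeps this representative of j - (i + 1) from being truncated at 0. *)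
  have [j rj] := phi_rec C s0 ap zp; exists (j + m * i.+1 - i.+1); apply: recurrent_at_mod rj.
  have h : i.+1 <= j + m * i.+1 by rewrite (leq_trans _ (leq_addl _ _)) // leq_pmull.
  by rewrite -addSn subnKC // addnC mulnC modnMDl.
have [small|large] := boolP `[< exists2 y, interior phi i (s ++ y ++ s) &
    #|shifts i (s ++ y ++ s)| < #|shifts i s| >].
  have [y Iy ylt] := asboolW small.
  have := IHn i (s ++ y ++ s) (leq_trans ylt sn) Iy.
  rewrite -size_eq0 !size_cat addn_eq0 size_eq0 (negbTE s0) => /(_ isT) h.
  by have := @recurrent_at_sub phi i.+1 [::] s (y ++ s) s0 h; rewrite addn0.
have closed k k' : K k -> K k' -> K (k + k').
  move=> Kk Kk'; have [y [Iy yk]] := extend k Kk.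
  have eq_shifts : shifts i (s ++ y ++ s) = shifts i s.
    apply/eqP; rewrite eqEcard; apply/andP; split; last first.
      by rewrite leqNgt; apply/negP => h; move/asboolP: large; apply; exists y.
    apply/fintype.subsetP => q; rewrite !finset.in_set => /asboolW h; apply/asboolP.
    by have := @recurrent_at_sub phi _ [::] s (y ++ s) s0 h; rewrite addn0.
  have /shiftsP : ord_of k' \in shifts i (s ++ y ++ s) by rewrite eq_shifts; exact/shiftsP.
  rewrite catA -[s in _ ++ s]cats0 => /(recurrent_at_sub s0); apply: recurrent_at_mod.
  by rewrite addSn -addnA; apply: modnDS; rewrite -modnDmr yk modnDmr addnC.
have Kmul q : K (q.+1 * k0).
  by elim: q => [|q IHq]; [rewrite mul1n | rewrite mulSn; exact: closed].
(* The sum of [m] copies of [k0] is 0 modulo [m]. *)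
apply: recurrent_at_mod (Kmul m.-1).
by rewrite prednK // -addSn mulnC addnC modnMDl.
Qed.
End Returns.
End LocalRestriction.

Section InfiniteSets.
Local Open Scope nat_scope.
Local Open Scope classical_set_scope.

Lemma infinite_set_unbounded (A : set nat) : infinite_set A ->
  forall N, exists2 x, N <= x & A x.
Proof.
move=> iA N; apply: contrapT => H; apply: iA.
apply: (@sub_finite_set _ _ `I_N); last exact: finite_II.
by move=> x Ax /=; rewrite ltnNge; apply/negP => Nx; apply: H; exists x.
Qed.

Lemma unbounded_infinite_set (A : set nat) : (forall N, exists2 x, N <= x & A x) ->
  infinite_set A.
Proof.
move=> H /finite_seqP[s sA]; have [x] := H (\max_(y <- s) y).+1.
rewrite sA /= => sx xs; have : x <= \max_(y <- s) y by exact: leq_bigmax_seq.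
by rewrite leqNgt sx.
Qed.

End InfiniteSets.

(** * Interior words, hull and loops of similar classes *)

Section SimilarClasses.
Local Open Scope nat_scope.
Variables m p : nat.
Hypotheses (m0 : 0 < m) (p0 : 0 < p).
Implicit Types (phi : lrf m p) (s t : nat * seq nat).

Lemma interior_connected phi i j u v : recurrent phi ->
  interior phi i u -> interior phi j v -> v != [::] ->
  exists2 y, interior phi i (u ++ y ++ v) & i + size u + size y = j %[mod m].
Proof.
move=> phi_rec [a [z [ap zp C ai]]] Iv v0.
have rv := interior_recurrent m0 phi_rec Iv v0.
have [|||y1 [y2 [C' jE]]] := @recurrent_occurs m p phi j.+1 v (a ++ u) [::] z rv.
- by rewrite -catA.
- by rewrite size_cat (leq_trans ap) // leq_addr.
- by [].
exists y1.
  exists a, (y2 ++ z); split=> //; first by rewrite size_cat (leq_trans zp) // leq_addl.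
  by rewrite -!catA in C' *.
have /eqP : size (a ++ u) + size y1 = j %[mod m].
  by apply/eqP; rewrite -(eqn_modDr 1) !addn1; apply/eqP.
by rewrite size_cat -addnA -modnDml ai modnDml addnA => /eqP.
Qed.

Section Free.
Variable phi : lrf m p.
Hypothesis phi_free : asymptotically_free phi.

Lemma free_long : exists c, comp_class phi c /\ p + p <= size c.
Proof.
case: phi_free => _ _ [j [l [r /infinite_set_unbounded /(_ 0)[x _ [_ [c Cc infx] _]]]]].
exists c; split=> //; apply: leq_trans (size_infix infx).
by rewrite size_cat /= !size_tuple leq_add2l.
Qed.

Lemma free_interior : exists j l r, [/\ size l = p, size r = p &
  forall N, exists2 x, N <= x & interior phi j (l ++ x :: r)].
Proof.
case: phi_free => _ _ [j [l [r /infinite_set_unbounded H]]].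
exists (j + m - 1), l, r; rewrite !size_tuple; split=> // N.
have [x Nx rx] := H N; exists x => //; apply: interior_of_recurrent free_long.
by apply: recurrent_at_mod rx; rewrite subn1 prednK ?modnDr // addn_gt0 m0 orbT.
Qed.

Lemma interior_free j (l r : seq nat) : size l = p -> size r = p ->
  (forall N, exists2 x, N <= x & interior phi j (l ++ x :: r)) ->
  exists M, forall x, M <= x -> interior phi j (l ++ x :: r).
Proof.
move=> /eqP lp /eqP rp; move=> H; case: phi_free => phi_rec hfree _.
have inf : inf_recurrent phi j.+1 (Tuple lp) (Tuple rp).
  apply: unbounded_infinite_set => N; have [x Nx Ix] := H N; exists x => //=.
  by apply: interior_recurrent => //; rewrite -size_eq0 size_cat /= addnS.
have [M hM] := hfree _ _ _ inf; exists M => x' Mx'.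
have [x _ [a [z [ap zp C ai]]]] := H 0; exists a, z; split=> //.
by apply: (hM x a z C _ x' Mx'); apply/eqP; rewrite -[_.+1]addn1 -[j.+1]addn1 eqn_modDr ai.
Qed.

(** Once a class of a recurrent function has a composition with 2p parts, a nonempty word is
    interior at i exactly when it is recurrent at i + 1, and similarity compares the latter. *)
Lemma similar_interior phi' : similar phi phi' ->
  (exists c, comp_class phi' c /\ p + p <= size c) /\
  exists k, forall i u, u != [::] -> interior phi i u <-> interior phi' (i + k) u.
Proof.
move=> [phi_rec phi'_rec [k hk]].
have long' : exists c, comp_class phi' c /\ p + p <= size c.
  have [j [l [r [lp rp H]]]] := free_interior; have [x _ Ix] := H 0.
  have lr0 : l ++ x :: r != [::] by rewrite -size_eq0 size_cat /= addnS.
  have /hk[_ [c Cc infx] _] := interior_recurrent m0 phi_rec Ix lr0.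
  exists c; split=> //; apply: leq_trans (size_infix infx).
  by rewrite size_cat /= lp rp leq_add2l.
split=> //; exists k => i u u0; split => Iu; apply: interior_of_recurrent.
- by rewrite -addSn; apply/hk; exact: interior_recurrent.
- by [].
- by apply/hk; rewrite addSn; exact: interior_recurrent.
- exact: free_long.
Qed.

Lemma class_hull phi' c : similar phi phi' -> comp_class phi' c -> hull p (interior phi) c.
Proof.
move=> sim Cc; have cpos : all (leq 1) c by case: Cc.
have [cp|cp] := leqP (size c) (p + p); [by left | right].
have [_ [k hk]] := similar_interior sim.
set a := take p c; set b := take (size c - (p + p)) (drop p c).
set z := drop (size c - (p + p)) (drop p c).
have cE : c = a ++ b ++ z by rewrite !cat_take_drop.
have sa : size a = p by rewrite size_takel //; lia.
have sz : size z = p by rewrite !size_drop; lia.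
have sb : size b = size c - (p + p) by rewrite size_takel // size_drop; lia.
have b0 : b != [::] by rewrite -size_eq0 sb -lt0n subn_gt0.
move: cpos; rewrite {1}cE !all_cat => /and3P[pa _ pz].
exists a, (b ++ z); split; rewrite ?sa //; exists b, z; split; rewrite ?sz //.
have kmk : k <= m * k by rewrite leq_pmull.
(* m k - k undoes the shift by k modulo m within the natural numbers. *)
exists (p + (m * k - k)); apply/hk => //; rewrite -addnA subnK //.
exists a, z; split; rewrite ?sa ?sz //; first by rewrite -cE.
by rewrite addnC mulnC modnMDl.
Qed.

(** [a] and [z] come from a single member containing the block of [s]; the splices take place at the
    first and at the last copy of that block in [s.2 ++ w], whatever the loop [w]. *)
Lemma class_loop phi' s : similar phi phi' -> size s.2 = p -> interior phi s.1 s.2 ->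
  exists a z, forall w, loop m (interior phi) s w -> comp_class phi' (a ++ w ++ z).
Proof.
move=> sim sp Is; have [_ [k hk]] := similar_interior sim.
have s0 : s.2 != [::] by rewrite -size_eq0 sp -lt0n.
have [a [z [_ _ C ai]]] := (hk _ _ s0).1 Is.
exists (a ++ s.2), z => w lw; have [y yE sy] := walk_suffix p0 sp sp lw.
have sw0 : s.2 ++ w != [::] by rewrite -size_eq0 size_cat sp -lt0n addn_gt0 p0.
have [a' [z' [_ _ C' ai']]] := (hk _ _ sw0).1 lw.1.
have C1 : comp_class phi' (a ++ s.2 ++ w ++ z').
  move: C'; rewrite -catA; apply: comp_class_splice C; first by rewrite sp.
  by rewrite ai ai'.
have := @comp_class_splice m p phi' (a ++ y) a s.2 z' z.
rewrite sp -!catA; have -> : a ++ s.2 ++ w ++ z = a ++ y ++ s.2 ++ z.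
  by rewrite [s.2 ++ _]catA yE -catA.
apply=> //; last by move: C1; rewrite [s.2 ++ _]catA yE -catA.
rewrite size_cat sy -modnDml ai modnDml -addnA [k + _]addnC addnA -modnDml.
by rewrite (walk_mod lw) modnDml.
Qed.

End Free.

Lemma letter_stat_le (w : seq nat) k : all (leq 1) w ->
  count_mem k w <= size w /\ size w <= sumn w.
Proof.
move=> wp; split; first exact: count_size.
by elim: w wp => //= a w IHw /andP[a1 /IHw]; rewrite -add1n; exact: leq_add.
Qed.

End SimilarClasses.

(** * Limits determined by one asymptotically free function *)

Section Asymptotics.
Variable R : realType.
Variables m p : nat.
Hypotheses (m0 : (0 < m)%N) (p0 : (0 < p)%N).
Variable phi : lrf m p.
Hypothesis phi_free : asymptotically_free phi.

(** All constants are built from [phi] before [Psi] is quantified; this order is what makes them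
    common to the similar classes. *)
Lemma class_asymptotics : exists (r f v0 : R) (v : nat -> R),
  [/\ 0 < r < 1, 0 < f, 0 < v0,
      forall e, 0 < e -> exists N, forall k, (N <= k)%N -> `|v k / r ^+ k - f| <= e
    & forall (Psi : set (lrf m p)) (F : nat -> seq (seq nat)),
      (exists psi, Psi psi) -> (forall psi, Psi psi -> similar phi psi) ->
      (forall n, uniq (F n)) ->
      (forall n c, c \in F n <-> union_class Psi c /\ sumn c = n) ->
      [/\ forall x, 0 < x < r -> exists M, forall n, (size (F n))%:R * x ^+ n <= M,
          forall x M, r < x -> exists n, M < (size (F n))%:R * x ^+ n,
          forall e, 0 < e -> exists N, forall n, (N <= n)%N ->
            `|(\sum_(c <- F n) (size c)%:R) / (size (F n))%:R / n%:R - v0| <= e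
        & forall k e, 0 < e -> exists N, forall n, (N <= n)%N ->
            `|(\sum_(c <- F n) (count_mem k c)%:R) / (size (F n))%:R / n%:R - v k| <= e]].
Proof.
have [phi_rec _ _] := phi_free; pose I := interior phi.
have Il : local_family m p I := interior_local phi.
have Iconn := fun i j u v => @interior_connected m p m0 phi i j u v phi_rec.
have Ifree := interior_free m0 phi_free.
have [j [l [t [lp tp jfree]]]] := free_interior m0 phi_free.
pose s := free_state p j t.
have sp : size s.2 = p by [].
have Is : I s.1 s.2 := free_state_in Il lp jfree.
have [v [M hM]] := free_prime_loops m0 p0 Il Iconn Ifree lp tp jfree.
have P_pos := prime_pos (s := s) Il.
have neq : v ++ M :: t != v ++ M.+1 :: t.
  by apply/eqP => /(congr1 sumn); rewrite !sumn_cat /=; lia.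
have [r [r01 P_r P_growth]] := radius_exists R P_pos (hM M (leqnn _)) (hM _ (leqnSn _)) neq.
have [y [My [/andP[ry y1] avoiding_y']]] := bsum_avoiding_gap m0 p0 Il Iconn r01 sp Is P_r.
have [r0 r1] := andP r01.
have y01 : 0 < y < 1 by rewrite (lt_trans r0 ry).
have avoiding_y : exists M, bsum (somewhere (avoiding m I s)) (pw y) M by exists My.
have P_y : exists M, bsum (prime_loop m I s) (pw y) M.
  exists (My / pw y (behead s.2) * (y ^+ 0 / (1 - y))).
  exact: (bsum_prime_avoiding p0 y01 Il sp avoiding_y').
have P_ex : exists w, prime_loop m I s w by exists (v ++ M :: t); exact: hM.
have loop_sums : exists N, forall n, (N <= n)%N -> exists2 w, loop m I s w & sumn w = n.
  (* The free part of the loop is adjusted to reach any large sum. *)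
  exists (sumn v + M + sumn t)%N => n Nn.
  exists (v ++ (n - sumn v - sumn t)%N :: t).
    by have [] := hM (n - sumn v - sumn t)%N ltac:(lia).
  by rewrite sumn_cat /=; lia.
pose sz := fun w : seq nat => (size w)%:R : R.
pose ct k := fun w : seq nat => (count_mem k w)%:R : R.
have sz_le w : all (leq 1) w -> 0 <= sz w <= (sumn w)%:R.
  by move=> /(letter_stat_le 0)[_ h]; rewrite ler0n ler_nat.
have ct_le k w : all (leq 1) w -> 0 <= ct k w <= (sumn w)%:R.
  by move=> /(letter_stat_le k)[h1 h2]; rewrite ler0n ler_nat (leq_trans h1).
pose mu := moment m I s r (fun w => (sumn w)%:R : R).
have mu0 : 0 < mu by exact: (moment_sz_gt0 Il r0 ry P_y P_ex).
pose Finf := ssum (eventual_hole m I s) (pair_weight r).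
exists r, (Finf / mu), (mean m I s r sz), (fun k => mean m I s r (ct k)); split=> //.
- rewrite divr_gt0 //; apply: (eventual_hole_gt0 p0 Il sp r0 ry y1 avoiding_y).
  by exists (v, t), M => k; exact: hM.
- rewrite divr_gt0 //; have [w Pw] := P_ex; have [wp w0] := P_pos w Pw.
  have := @bsum_moment _ _ _ _ Il s r y r0 ry P_y sz sz_le [:: w] isT.
  rewrite big_seq1 => h; apply: lt_le_trans (h _); last by move=> u; rewrite inE => /eqP->.
  by rewrite mulr_gt0 ?pw_gt0 // ltr0n lt0n size_eq0.
- move=> e e0; have emu : 0 < e * mu by rewrite mulr_gt0.
  have [N hN] := hole_limit p0 Il Ifree sp r0 ry y1 avoiding_y emu.
  exists (maxn N (\max_(a <- s.2) a).+1) => k; rewrite geq_max => /andP[/hN h /big_notin ks].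
  rewrite /mean (moment_count p0 Il sp r0 ry y1 avoiding_y ks); last first.
    exact: (bsum_moment Il r0 ry P_y (ct_le k)).
  have rk : r ^+ k != 0 by rewrite gt_eqF // exprn_gt0.
  have mun : mu != 0 by rewrite gt_eqF.
  have -> : r ^+ k * ssum (hole m I s k) (pair_weight r) / mu / r ^+ k - Finf / mu =
      (ssum (hole m I s k) (pair_weight r) - Finf) / mu by field; rewrite mun rk.
  by rewrite normrM (@gtr0_norm _ mu^-1) ?invr_gt0 // ler_pdivrMr.
move=> Psi F [psi Ppsi] sim uF FE.
have F_hull n c : c \in F n -> hull p I c /\ sumn c = n.
  move=> /FE[[psi' /sim sim' Cc] cn]; split=> //; exact: (class_hull m0 p0 phi_free sim' Cc).
have F_loop : exists a z, forall w, loop m I s w -> a ++ w ++ z \in F (sumn (a ++ w ++ z)).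
  have [a [z h]] := class_loop m0 p0 phi_free (sim _ Ppsi) sp Is.
  by exists a, z => w /h Cw; apply/FE; split=> //; exists psi.
have average X X_nil X_cat X_le := @average_limit R m p p0 I Il s sp r y r0 ry y1 P_r P_growth
  P_y avoiding_y loop_sums F uF F_hull F_loop X X_nil X_cat X_le P_ex.
split.
- exact: (F_upper p0 Il sp r0 ry y1 P_r avoiding_y uF F_hull).
- by move=> x M'; exact: (F_unbounded p0 Il sp r0 ry y1 P_growth loop_sums F_loop).
- apply: average => //.
  by move=> u w; rewrite /sz size_cat natrD.
move=> k; apply: average => //.
  by move=> u w; rewrite /ct count_cat natrD.
exact: ct_le.
Qed.

End Asymptotics.

(** * The constants *)

(* Imported only here: Rstruct shadows [expR0] and [expRD]. *)
From mathcomp Require Import Rstruct.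

Section StdlibAsymptotics.
Import Rdefinitions Raxioms Rbasic_fun Rpow_def.
Variables m p : nat.
Hypotheses (m0 : leq 1 m) (p0 : leq 1 p).
Variable phi : lrf m p.
Hypothesis phi_free : asymptotically_free phi.

Lemma mem_fclass (Psi : set (lrf m p)) n c :
  c \in (fclass Psi n : seq (seq nat)) <-> union_class Psi c /\ sumn c = n.
Proof.
rewrite -[c \in _]/(c \in fset_set (class_of_sum Psi n)) in_fset_set; last first.
  exact: finite_class_of_sum.
by split=> [/set_mem|] // h; apply/mem_set.
Qed.

Lemma expectE (Psi : set (lrf m p)) n (X : seq nat -> nat) : expect Psi n X =
  (\sum_(c <- fclass Psi n) (X c)%:R) / (size (fclass Psi n : seq (seq nat)))%:R.
Proof. by rewrite /expect /num RdivE !INRE natr_sum. Qed.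

Lemma class_asymptotics_Stdlib : exists (r f v0 : R) (v : nat -> R),
  [/\ Rlt R0 r, Rlt R0 f, Rlt R0 v0,
      forall e, Rlt R0 e -> exists N, forall k, leq N k ->
        Rle (Rabs (Rminus (Rdiv (v k) (pow r k)) f)) e
    & forall Psi : set (lrf m p),
      (exists psi, Psi psi) -> (forall psi, Psi psi -> similar phi psi) ->
      [/\ forall x, Rlt R0 x -> Rlt x r ->
            exists M, forall n, Rle (Rmult (num Psi n) (pow x n)) M,
          forall x M, Rlt r x -> exists n, Rlt M (Rmult (num Psi n) (pow x n)),
          forall e, Rlt R0 e -> exists N, forall n, leq N n ->
            Rle (Rabs (Rminus (Rdiv (expect Psi n size) (INR n)) v0)) e
        & forall k e, Rlt R0 e -> exists N, forall n, leq N n ->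
            Rle (Rabs (Rminus (Rdiv (expect Psi n (count_mem k)) (INR n)) (v k))) e]].
Proof.
have [r [f [v0 [v [/andP[r0 r1] f0 v00 hv H]]]]] := @class_asymptotics R m p m0 p0 phi phi_free.
exists r, f, v0, v; split; [exact/RltP|exact/RltP|exact/RltP| |].
  move=> e /RltP e0; have [N hN] := hv e e0; exists N => k /hN h.
  by apply/RleP; rewrite RpowE RdivE.
move=> Psi Psi0 sim.
have [h1 h2 h3 h4] := H Psi (fun n => fclass Psi n) Psi0 sim
  (fun n => fset_uniq _) (mem_fclass Psi); split.
- move=> x /RltP x0 /RltP xr; have [|M hM] := h1 x; first by rewrite x0.
  by exists M => n; apply/RleP; rewrite RpowE /num INRE; exact: hM.
- move=> x M /RltP /(h2 x M)[n hn]; exists n; apply/RltP.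
  by rewrite RpowE /num INRE; exact: hn.
- move=> e /RltP /h3[N hN]; exists N => n /hN h.
  by apply/RleP; rewrite expectE INRE RdivE.
- move=> k e /RltP /(h4 k)[N hN]; exists N => n /hN h.
  by apply/RleP; rewrite expectE INRE RdivE.
Qed.

End StdlibAsymptotics.

(* Imported only here: these rebind the scope delimiters %N and %R. *)
From Stdlib Require Import Reals.
From Coquelicot Require Import Coquelicot.

Section Constants.
Local Open Scope R_scope.

Lemma is_lim_seq_close (u : nat -> R) (l : R) :
  (forall e, 0 < e -> exists N, forall n, leq N n -> Rabs (u n - l) <= e) ->
  is_lim_seq u (Finite l).
Proof.
move=> H; apply/is_lim_seq_spec => e; have e0 := cond_pos e.
have [|N hN] := H (e / 2); first by Lra.lra.
exists N => n /ssrnat.leP Nn; apply: Rle_lt_trans (hN n Nn) _; Lra.lra.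
Qed.

Lemma class_constants m p (phi : lrf m p) : leq 1 m -> leq 1 p -> asymptotically_free phi ->
  exists r B C, forall Psi : set (lrf m p),
    (exists psi, Psi psi) -> (forall psi, Psi psi -> similar phi psi) ->
    has_constants Psi r B C.
Proof.
move=> m0 p0 phi_free.
have [r [f [v0 [v [r0 f0 v00 hv H]]]]] := class_asymptotics_Stdlib m0 p0 phi_free.
(* Here u_k is [v k / v0] and the number of parts per unit of sum tends to [v0], so B is [f / v0]
   and C is [f] left unsimplified. *)
exists r, (f / v0), (f / v0 * v0) => Psi Psi0 sim.
have [h1 h2 h3 h4] := H Psi Psi0 sim.
have num0 n : 0 <= Defs.num Psi n by exact: pos_INR.
split; last split.
(* The radius is the supremum of the x at which the terms [num n * x ^ n] stay bounded: all x in (0,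
   r) qualify, no x > r does. *)
- rewrite -(is_lub_Rbar_unique _ _ (CV_radius_bounded (Defs.num Psi))).
  apply: is_lub_Rbar_unique; split.
    move=> x [M hM] /=; apply: Rnot_lt_le => rx; have [n hn] := h2 x M rx.
    have := hM n; have := Rle_abs (Defs.num Psi n * x ^ n); Lra.lra.
  move=> [b| |] hb //=.
    apply: Rnot_lt_le => br; pose x := (Rmax b 0 + r) / 2.
    have [bx xr x0] : [/\ b < x, x < r & 0 < x].
      have := Rmax_l b 0; have := Rmax_r b 0; have := Rmax_lub_lt b 0 r br r0.
      by rewrite /x; split; Lra.lra.
    have [M hM] := h1 x x0 xr; have : x <= b; last by Lra.lra.
    apply: (hb x); exists M => n; rewrite Rabs_pos_eq //.
    by apply: Rmult_le_pos => //; apply: pow_le; Lra.lra.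
  have [M hM] := h1 (r / 2) ltac:(Lra.lra) ltac:(Lra.lra).
  apply: (hb (r / 2)); exists M => n; rewrite Rabs_pos_eq //.
  by apply: Rmult_le_pos => //; apply: pow_le; Lra.lra.
- by apply: Rdiv_lt_0_compat.
have lim_size : is_lim_seq (fun n => expect Psi n size / INR n) (Finite v0).
  exact: is_lim_seq_close.
exists (fun k => v k / v0), v0; split; last split; last by split.
  move=> k _; have lim_k := is_lim_seq_close (h4 k).
  have := is_lim_seq_div' _ _ _ _ lim_k lim_size (Rgt_not_eq _ _ v00).
  apply: is_lim_seq_ext_loc; exists 1%nat => n n1; have n0 : INR n <> 0.
    by apply: not_0_INR => n0; rewrite n0 in n1; inversion n1.
  by rewrite /Rdiv Rinv_mult Rinv_inv Rmult_assoc -(Rmult_assoc (/ INR n)) (Rmult_comm (/ INR n))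
    Rmult_assoc Rinv_l // Rmult_1_r.
have := is_lim_seq_div' _ _ _ _ (is_lim_seq_close hv) (is_lim_seq_const f) (Rgt_not_eq _ _ f0).
rewrite Rdiv_diag; last exact: Rgt_not_eq.
apply: is_lim_seq_ext => k; rewrite /Rdiv !Rinv_mult Rinv_inv.
rewrite !Rmult_assoc; congr (_ * _).
rewrite -(Rmult_assoc (/ f)) (Rmult_comm (/ f) v0) Rmult_assoc -(Rmult_assoc (/ v0)).
by rewrite Rinv_l ?Rmult_1_l 1?Rmult_comm //; exact: Rgt_not_eq.
Qed.

End Constants.

Local Open Scope nat_scope.

Theorem theorem1 (m p : nat) (hm : (0 < m)%N) (hp : (0 < p)%N)
    (Phi Phi' : set (lrf m p))
    (hPhi : asymptotically_free_set Phi)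
    (hfin' : finite_set Phi')
    (hne' : exists phi', Phi' phi')
    (hsim : forall phi phi', Phi phi -> Phi' phi' -> similar phi phi') :
  exists r B C : R, has_constants Phi r B C /\ has_constants Phi' r B C.
Proof.
have [_ simPhi [phi Pphi phi_free]] := hPhi.
have [r [B [C H]]] := class_constants hm hp phi_free.
exists r, B, C; split; apply: H => //; first by exists phi.
- by move=> psi; exact: simPhi.
- by move=> psi; exact: hsim.
Qed.
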